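(* Let $m,n\in\mathbb{N}$. Let either $1 \leq q_1, \dots, q_m <r < 2$, or $r=2$ and $1 \leq q_1, \dots, q_m <\infty$, and let $p>0$ be such that $\frac{1}{p}=\frac{1}{q_1}+\cdots+\frac{1}{q_m}$. Suppose $\vec w=(w_1,\dots,w_m)$ satisfies the multilinear $A_{\vec q}$ condition on $\mathbb{R}^n$ and put $\nu_{\vec w}=\prod_{i=1}^m w_i^{p/q_i}$. Then there exists a constant $C>0$ such that for every $m$-linear Calderón-Zygmund operator $T$ on $\mathbb{R}^n$ and all sequences of functions $\{f^i_{k_i}\}_{k_i}\subset L^{q_i}(w_i)$, $1\le i\le m$, the following estimates hold. (i) If $q_i>1$ for all $1 \leq i \leq m$, then $$\left\| \left( \sum_{k_1, \dots, k_m} |T(f^1_{k_1}, \dots, f^m_{k_m})|^r \right)^{\frac{1}{r}} \right\|_{L^p(\nu_{\vec w})} \leq C \|T\| \prod_{i=1}^m \left\| \left( \sum_{k_i} |f^i_{k_i}|^{r} \right)^{\frac{1}{r}} \right\|_{L^{q_i}(w_i)}.$$ (ii) If at least one $q_i=1$, then $$\left\| \left( \sum_{k_1, \dots, k_m} |T(f^1_{k_1}, \dots, f^m_{k_m})|^r \right)^{\frac{1}{r}} \right\|_{L^{p,\infty}(\nu_{\vec w})} \leq C e^{\frac{1}{p}} \|T\|_{weak} \prod_{i=1}^m \left\| \left( \sum_{k_i} |f^i_{k_i}|^{r} \right)^{\frac{1}{r}} \right\|_{L^{q_i}(w_i)}.$$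
   Context: All function spaces are real. A weight is a nonnegative locally integrable function $w$ on $\mathbb{R}^n$, and $L^q(w)$, $L^{q,\infty}(w)$ are the Lebesgue and weak Lebesgue spaces for the measure $w(x)\,dx$; $\|f\|_{L^{p,\infty}(\nu)}=\sup_{\lambda>0}\lambda\,\nu(\{|f|>\lambda\})^{1/p}$. Multilinear $A_{\vec q}$ condition: for $1\le q_1,\dots,q_m<\infty$, $\frac1p=\frac1{q_1}+\cdots+\frac1{q_m}$, $\vec q=(q_1,\dots,q_m)$, a tuple of weights $\vec w=(w_1,\dots,w_m)$ satisfies it if $$\sup_{Q}\Big(\frac{1}{|Q|}\int_Q\nu_{\vec w}\Big)^{1/p}\prod_{i=1}^m\Big(\frac{1}{|Q|}\int_Q w_i^{1-q'_i}\Big)^{1/q'_i}<\infty,\qquad \nu_{\vec w}=\prod_{i=1}^m w_i^{p/q_i},$$ where the supremum is over all cubes $Q\subset\mathbb{R}^n$, $q_i'$ is the conjugate exponent of $q_i$, and for $q_i=1$ the factor $\big(\frac{1}{|Q|}\int_Q w_i^{1-q'_i}\big)^{1/q'_i}$ is understood as $(\inf_Q w_i)^{-1}$ (essential infimum). $m$-linear Calderón-Zygmund operator: a multilinear operator $T\colon S(\mathbb{R}^n)\times\cdots\times S(\mathbb{R}^n)\to S'(\mathbb{R}^n)$ (Schwartz functions to tempered distributions) which, for some $1\le s_1,\dots,s_m<\infty$ and $\frac1m\le s<\infty$ with $\frac1s=\frac1{s_1}+\cdots+\frac1{s_m}$, extends to a bounded multilinear operator $L^{s_1}\times\cdots\times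 L^{s_m}\to L^s$, and for which there is a function $K$ defined off the diagonal $x=y_1=\cdots=y_m$ in $(\mathbb{R}^n)^{m+1}$ such that $$T(f^1,\dots,f^m)(x)=\int_{\mathbb{R}^n}\cdots\int_{\mathbb{R}^n}K(x,y_1,\dots,y_m)\prod_{i=1}^m f^i(y_i)\,dy_1\cdots dy_m$$ for all $x\notin\bigcap_{i=1}^m \operatorname{supp} f^i$ ($f^i$ smooth with compact support), and satisfying, for some $A,\varepsilon>0$, writing $y_0=x$, the decay condition $|K(y_0,\dots,y_m)|\le A\big(\sum_{k,l=0}^m|y_k-y_l|\big)^{-mn}$ and the smoothness condition $$|K(y_0,\dots,y_j,\dots,y_m)-K(y_0,\dots,y_j',\dots,y_m)|\le \frac{A|y_j-y_j'|^{\varepsilon}}{\big(\sum_{k,l=0}^m|y_k-y_l|\big)^{mn+\varepsilon}}$$ for $0\le j\le m$ whenever $|y_j-y_j'|\le\frac12\max_{0\le k\le m}|y_j-y_k|$. For $\vec w$ satisfying the $A_{\vec q}$ condition, it is a known theorem (Lerner, Ombrosi, Pérez, Torres, Trujillo-González) that such a $T$ extends boundedly $L^{q_1}(w_1)\times\cdots\times L^{q_m}(w_m)\to L^p(\nu_{\vec w})$ if all $q_i>1$, and $L^{q_1}(w_1)\times\cdots\times L^{q_m}(w_m)\to L^{p,\infty}(\nu_{\vec w})$ if at least one $q_i=1$; $\|T\|$ and $\|T\|_{weak}$ denote the respective operator norms of these extensions. *)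

(* Defs.v *)
From HB Require Import structures.
From mathcomp Require Import all_boot all_order all_algebra.
From mathcomp Require Import all_classical all_reals all_analysis.
From mathcomp Require Import measurable_realfun ess_sup_inf.

Set Implicit Arguments.
Unset Strict Implicit.
Unset Printing Implicit Defensive.
Import Order.TTheory GRing.Theory Num.Theory.
Import numFieldNormedType.Exports.
Local Open Scope classical_set_scope.
Local Open Scope ring_scope.

Section pushforward.
Context d1 d2 (T1 : measurableType d1) (T2 : measurableType d2) (R : realType).
Variables (f : T1 -> T2) (g : T2 -> T1).

Lemma pushforward_sigma_additive (m : {measure set T1 -> \bar R}) :
  measurable_fun [set: T1] f -> semi_sigma_additive (pushforward m f).
Proof.
move=> mf F mF tF mUF; rewrite /pushforward preimage_bigcup.
apply: measure_semi_sigma_additive.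
- by move=> k; rewrite -[X in measurable X]setTI; exact: mf.
- apply/trivIsetP => /= i j _ _ ij; rewrite -preimage_setI.
  by move/trivIsetP : tF => /(_ _ _ _ _ ij) ->//; rewrite preimage_set0.
- by rewrite -preimage_bigcup -[X in measurable X]setTI; exact: mf.
Qed.

Lemma pushforward_sigma_finite (m : set T1 -> \bar R) :
  sigma_finite [set: T1] m -> measurable_fun [set: T2] g -> cancel f g ->
  sigma_finite [set: T2] (pushforward m f).
Proof.
move=> [F FT F_fin] mg fK.
exists (fun i => g @^-1` F i).
  by rewrite -preimage_bigcup -FT preimage_setT.
move=> i; have [mF Fi] := F_fin i; split.
  by rewrite -[X in measurable X]setTI; exact: mg.
rewrite /pushforward -comp_preimage (_ : g \o f = id) ?preimage_id//.
by apply/funext => x /=; rewrite fK.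
Qed.

End pushforward.

Lemma product_sigma_finite d1 d2 (T1 : measurableType d1)
    (T2 : measurableType d2) (R : realType)
    (m1 : {sigma_finite_measure set T1 -> \bar R})
    (m2 : {sigma_finite_measure set T2 -> \bar R}) :
  sigma_finite [set: (T1 * T2)%type] (m1 \x m2)%E.
Proof.
have /sigma_finiteP[F [TF ndF Foo]] := sigma_finiteT m1.
have /sigma_finiteP[G [TG ndG Goo]] := sigma_finiteT m2.
exists (fun n => F n `*` G n).
  rewrite -setXTT TF TG predeqE => -[x y]; split.
    move=> [/= [n _ Fnx] [k _ Gky]]; exists (maxn n k) => //; split.
    - by move: x Fnx; exact/subsetPset/ndF/leq_maxl.
    - by move: y Gky; exact/subsetPset/ndG/leq_maxr.
  by move=> [n _ []/= ? ?]; split; exists n.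
move=> k; have [? ?] := Foo k; have [? ?] := Goo k.
split; first exact: measurableX.
by rewrite product_measure1E// lte_mul_pinfty// ge0_fin_numE.
Qed.

Section tuple_measure.
Context d (T : measurableType d) (R : realType).
Local Open Scope ereal_scope.

Definition cons_pair n (x : T * n.-tuple T) : n.+1.-tuple T :=
  [tuple of x.1 :: x.2].

Definition uncons_pair n (t : n.+1.-tuple T) : T * n.-tuple T :=
  (thead t, [tuple of behead t]).

Lemma cons_pairK n : cancel (@cons_pair n) (@uncons_pair n).
Proof.
by move=> [x t]; rewrite /uncons_pair /cons_pair theadE; congr pair; exact: val_inj.
Qed.

Lemma measurable_cons_pair n :
  measurable_fun [set: T * n.-tuple T] (@cons_pair n).
Proof. exact: (measurable_cons measurable_fst measurable_snd). Qed.

Lemma measurable_uncons_pair n :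
  measurable_fun [set: n.+1.-tuple T] (@uncons_pair n).
Proof.
by apply: measurable_fun_pair; [exact: measurable_tnth|exact: measurable_behead].
Qed.

Section cons_measure.
Variables (n : nat) (m1 : {sigma_finite_measure set T -> \bar R}).
Variable m2 : {sigma_finite_measure set (n.-tuple T) -> \bar R}.

Definition cons_measure : set (n.+1.-tuple T) -> \bar R :=
  pushforward (m1 \x m2) (@cons_pair n).

Let cons_measure0 : cons_measure set0 = 0.
Proof. by rewrite /cons_measure /pushforward preimage_set0 measure0. Qed.

Let cons_measure_ge0 A : 0 <= cons_measure A.
Proof. by rewrite /cons_measure /pushforward; exact: measure_ge0. Qed.

Let cons_measure_sigma_additive : semi_sigma_additive cons_measure.
Proof. exact: pushforward_sigma_additive (@measurable_cons_pair n). Qed.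

HB.instance Definition _ := isMeasure.Build _ _ _ cons_measure
  cons_measure0 cons_measure_ge0 cons_measure_sigma_additive.

Let cons_measure_sigma_finite : sigma_finite [set: _] cons_measure.
Proof.
apply: pushforward_sigma_finite (@cons_pairK n).
- exact: product_sigma_finite.
- exact: measurable_uncons_pair.
Qed.

HB.instance Definition _ := Measure_isSigmaFinite.Build _ _ _ cons_measure
  cons_measure_sigma_finite.

End cons_measure.

(* the n-fold product measure [mu \x ... \x mu] on n-tuples *)
Fixpoint tuple_measure (mu : {sigma_finite_measure set T -> \bar R}) (n : nat) :
    {sigma_finite_measure set (n.-tuple T) -> \bar R} :=
  match n with
  | 0 => \d_([tuple] : 0.-tuple T)
  | k.+1 => cons_measure mu (tuple_measure mu k)
  end.

End tuple_measure.

Definition rV_coord (R : realType) n (i : 'I_n) (x : 'rV[R]_n) :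
  measurableTypeR R := x ord0 i.

(* ['rV[R]_n] carries the sigma-algebra generated by the coordinates, i.e. the
   Borel sets. *)
HB.instance Definition _ (R : realType) n :=
  @isMeasurable.Build default_measure_display 'rV[R]_n
    (g_sigma_preimage (@rV_coord R n)) (@sigma_algebra0 _ setT _)
    (@sigma_algebraC _ _) (@sigma_algebra_bigcup _ setT _).

Section lebesgue_rV.
Context (R : realType) (n : nat).
Local Open Scope ereal_scope.
Local Notation X := 'rV[R]_n.

Definition rV_of_tuple (t : n.-tuple (measurableTypeR R)) : X :=
  \row_i tnth t i.

Definition tuple_of_rV (x : X) : n.-tuple (measurableTypeR R) :=
  [tuple rV_coord i x | i < n].

Lemma rV_of_tupleK : cancel rV_of_tuple tuple_of_rV.
Proof. by move=> t; apply: eq_from_tnth => i; rewrite tnth_mktuple /rV_coord mxE. Qed.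

Lemma measurable_rV_coord i : measurable_fun [set: X] (@rV_coord R n i).
Proof.
move=> _ Y mY; rewrite setTI; apply: sub_sigma_algebra => /=.
rewrite -bigcup_seq/=; exists i => /=; first by rewrite mem_index_enum.
by exists Y => //; rewrite setTI.
Qed.

Lemma measurable_rV_of_tuple : measurable_fun [set: n.-tuple _] rV_of_tuple.
Proof.
move=> _ A mA; rewrite setTI.
have : preimage_set_system setT rV_of_tuple
    (g_sigma_preimage (@rV_coord R n)) (rV_of_tuple @^-1` A).
  by exists A => //; rewrite setTI.
rewrite -g_sigma_preimage_comp (_ : (fun i => _) = fun i t => tnth t i)//.
by apply/funext => i; apply/funext => t; rewrite /= /rV_coord mxE.
Qed.

Lemma measurable_tuple_of_rV : measurable_fun [set: X] tuple_of_rV.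
Proof.
apply/measurable_fun_tnthP => i.
rewrite (_ : _ \o _ = @rV_coord R n i); first exact: measurable_rV_coord.
by apply/funext => x /=; rewrite tnth_mktuple.
Qed.

Definition lebesgue_rV : set X -> \bar R :=
  pushforward (tuple_measure (@lebesgue_measure R) n) rV_of_tuple.

Let lebesgue_rV0 : lebesgue_rV set0 = 0.
Proof. by rewrite /lebesgue_rV /pushforward preimage_set0 measure0. Qed.

Let lebesgue_rV_ge0 A : 0 <= lebesgue_rV A.
Proof. by rewrite /lebesgue_rV /pushforward; exact: measure_ge0. Qed.

Let lebesgue_rV_sigma_additive : semi_sigma_additive lebesgue_rV.
Proof. exact: pushforward_sigma_additive measurable_rV_of_tuple. Qed.

HB.instance Definition _ := isMeasure.Build _ _ _ lebesgue_rV
  lebesgue_rV0 lebesgue_rV_ge0 lebesgue_rV_sigma_additive.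

Let lebesgue_rV_sigma_finite : sigma_finite [set: _] lebesgue_rV.
Proof.
apply: pushforward_sigma_finite rV_of_tupleK.
  exact: sigma_finiteT.
exact: measurable_tuple_of_rV.
Qed.

HB.instance Definition _ := Measure_isSigmaFinite.Build _ _ _ lebesgue_rV
  lebesgue_rV_sigma_finite.

End lebesgue_rV.

Section euclidean.
Context (R : realType) (n : nat).
Local Notation X := 'rV[R]_n.
Local Notation leb := (@lebesgue_rV R n).

(* The norm of the normedModType structure of ['rV[R]_n] is the sup norm. *)
Definition enorm (x : X) : R := Num.sqrt (\sum_i x ord0 i ^+ 2).

Definition cube (a : X) (l : R) : set X :=
  [set x | forall i, a ord0 i <= x ord0 i <= a ord0 i + l].

Definition average (Q : set X) (f : X -> \bar R) : \bar R :=
  ((leb Q)^-1 * \int[leb]_(x in Q) f x)%E.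

Definition supp (f : X -> R) : set X := closure [set x | f x != 0].

(* [pderive [:: i1; ...; ik] f] is the iterated partial derivative
   d_i1 (... (d_ik f)). *)
Definition pderive (s : seq 'I_n) (f : X -> R) : X -> R :=
  foldr (fun i g x => 'D_(delta_mx ord0 i) g x) f s.

Definition smooth (f : X -> R) : Prop :=
  forall s, continuous (pderive s f) /\
    forall i x, derivable (pderive s f) x (delta_mx ord0 i).

Definition test_function (f : X -> R) : Prop := smooth f /\ compact (supp f).

Definition schwartz_norm (N : nat) (f : X -> R) : \bar R :=
  ereal_sup [set z | exists s x, (size s <= N)%N /\
    z = ((1 + enorm x) ^+ N * `|pderive s f x|)%:E].

Definition schwartz (f : X -> R) : Prop :=
  smooth f /\ forall N, (schwartz_norm N f < +oo)%E.

(* A functional is only looked at on Schwartz functions. *)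
Definition tempered_distribution (u : (X -> R) -> R) : Prop :=
  (forall (a : R) f g, schwartz f -> schwartz g ->
     u (fun x => a * f x + g x) = a * u f + u g) /\
  exists (N : nat) (C : R), forall f, schwartz f ->
    (`|u f|%:E <= C%:E * schwartz_norm N f)%E.

(* The tempered distribution [u] is the function [g]. *)
Definition represents (g : X -> R) (u : (X -> R) -> R) : Prop :=
  forall phi, schwartz phi ->
    leb.-integrable setT (fun x => (g x * phi x)%:E) /\
    u phi = \int[leb]_x (g x * phi x).

End euclidean.

Section weighted_measure.
Context (R : realType) (n : nat).
Local Notation X := 'rV[R]_n.
Local Notation leb := (@lebesgue_rV R n).
Local Open Scope ereal_scope.

Definition is_weight (w : {mfun X >-> R}) : Prop :=
  (forall x, (0 <= w x)%R) /\
  forall K, compact K -> leb.-integrable K (EFin \o w).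

(* The measure [w(x) dx]. Weights are nonnegative; the absolute value makes
   this a measure for every measurable [w]. *)
Definition weighted (w : {mfun X >-> R}) (A : set X) : \bar R :=
  \int[leb]_(x in A) `|w x|%:E.

Section weighted_is_measure.
Variable w : {mfun X >-> R}.

Let weighted0 : weighted w set0 = 0.
Proof. by rewrite /weighted integral_set0. Qed.

Let weighted_ge0 A : 0 <= weighted w A.
Proof. by apply: integral_ge0 => x _; rewrite lee_fin. Qed.

Let weighted_sigma_additive : semi_sigma_additive (weighted w).
Proof.
move=> F mF tF mUF; rewrite /weighted ge0_integral_bigcup//.
  apply: is_cvg_nneseries => k _ _; apply: integral_ge0 => x _.
  by rewrite lee_fin.
apply/measurable_EFinP; apply: measurableT_comp => //.
exact: (measurable_funTS (measurable_funPT w)).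
Qed.

HB.instance Definition _ := isMeasure.Build _ _ _ (weighted w)
  weighted0 weighted_ge0 weighted_sigma_additive.

End weighted_is_measure.

Section product_weight.
Variables (m : nat) (q : 'I_m -> R) (p : R) (w : 'I_m -> {mfun X >-> R}).

Definition product_weight (x : X) : R := (\prod_(i < m) w i x `^ (p / q i))%R.

Let measurable_product_weight : measurable_fun setT product_weight.
Proof.
apply: measurable_prod => i _.
exact: (measurableT_comp (measurable_powR (p / q i)) (measurable_funPT (w i))).
Qed.

HB.instance Definition _ :=
  isMeasurableFun.Build _ _ _ _ product_weight measurable_product_weight.
End product_weight.

End weighted_measure.

Section muckenhoupt.
Context (R : realType) (n m : nat).
Local Notation X := 'rV[R]_n.
Local Notation leb := (@lebesgue_rV R n).
Variables (q : 'I_m -> R) (p : R) (w : 'I_m -> {mfun X >-> R}).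
Local Open Scope ereal_scope.

(* The factor of the exponent [q] in the multilinear A_q condition. For the
   conjugate exponent [q' = q / (q - 1)], one has [w ^ (1 - q') =
   (w ^ (q' - 1))^-1]; with the inverse of [\bar R], this is [+oo] where
   [w = 0], whereas the [powR] of [0] to a negative exponent is [0]. *)
Definition Aq_factor (Q : set X) (q : R) (w : X -> R) : \bar R :=
  if q == 1%R then
    (ess_inf leb (fun x => if x \in Q then (w x)%:E else +oo))^-1
  else
    let q' := (q / (q - 1))%R in
    (average Q (fun x => (w x `^ (q' - 1))%R%:E^-1)) `^ q'^-1.

Definition multilinear_Aq : Prop :=
  ereal_sup [set z | exists (a : X) (l : R), (0 < l)%R /\
    let Q := cube a l in
    z = (average Q (EFin \o product_weight q p w)) `^ p^-1 *
        \big[*%E/1]_(i < m) Aq_factor Q (q i) (w i)] < +oo.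

End muckenhoupt.

Section multilinear_operators.
Context (R : realType) (n m : nat).
Local Notation X := 'rV[R]_n.
Local Notation leb := (@lebesgue_rV R n).
Implicit Types (f : 'I_m -> X -> R).

Definition multilinear_on (Z : Type) (D : 'I_m -> (X -> R) -> Prop)
    (eqZ : (Z -> R) -> (Z -> R) -> Prop) (B : ('I_m -> X -> R) -> Z -> R) :=
  forall (i : 'I_m) f (g : X -> R) (a : R), (forall j, D j (f j)) -> D i g ->
    eqZ (B [eta f with i |-> (fun x => a * f i x + g x)])
        (fun z => a * B f z + B [eta f with i |-> g] z).

Definition weak_Lnorm (nu : {measure set X -> \bar R}) (p : R)
    (f : X -> \bar R) : \bar R :=
  ereal_sup [set (l%:E * nu [set x | l%:E < `|f x|] `^ p^-1)%E
            | l in [set l : R | 0 < l]].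

Section bounded.
Variables (mu : 'I_m -> {measure set X -> \bar R}) (q : 'I_m -> R).
Variables (nu : {measure set X -> \bar R}).
(* the (quasi-)norm of the target space of functions modulo [nu] *)
Variable N : (X -> \bar R) -> \bar R.

(* Elements of Lebesgue spaces are represented by functions: multilinearity
   holds [nu]-almost everywhere, and boundedness makes [B f] depend only on the
   classes of the [f i]. *)
Definition bounded_multilinear (B : ('I_m -> X -> R) -> X -> R) : Prop :=
  [/\ forall f, (forall i, f i \in Lfun (mu i) (q i)%:E) ->
         measurable_fun setT (B f),
      multilinear_on (fun i g => g \in Lfun (mu i) (q i)%:E)
        (fun u v => u = v %[ae nu]) B &
      exists C : R, forall f, (forall i, f i \in Lfun (mu i) (q i)%:E) ->
        (N (EFin \o B f) <=
         C%:E * \big[*%E/1]_(i < m) Lnorm (mu i) (q i)%:E (EFin \o f i))%E].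

Definition operator_norm (B : ('I_m -> X -> R) -> X -> R) : \bar R :=
  ereal_sup [set N (EFin \o B f) | f in [set f | forall i,
    f i \in Lfun (mu i) (q i)%:E /\
    (Lnorm (mu i) (q i)%:E (EFin \o f i) <= 1)%E]].

(* Schwartz functions lie in all unweighted L^q. For a locally integrable
   weight they need not lie in L^q(w), but those that do contain the test
   functions, which are dense, so that the extension is unique. *)
Definition bounded_extension (T : ('I_m -> X -> R) -> (X -> R) -> R)
    (B : ('I_m -> X -> R) -> X -> R) : Prop :=
  bounded_multilinear B /\
  forall f, (forall i, schwartz (f i)) ->
    (forall i, f i \in Lfun (mu i) (q i)%:E) -> represents (B f) (T f).

End bounded.

(* The points [y_0 = x, y_1, ..., y_m] are indexed by ['I_m.+1]. *)
Definition on_diagonal (y : 'I_m.+1 -> X) : Prop := forall k l, y k = y l.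

Definition mutual_dist (y : 'I_m.+1 -> X) : R :=
  \sum_k \sum_l enorm (y k - y l).

(* [K] is defined off the diagonal: its values on the diagonal are not
   constrained. In the smoothness condition, the point with [y j] replaced by
   [y'] is off the diagonal whenever [y] is. *)
Definition CZ_kernel (K : ('I_m.+1 -> X) -> R) : Prop :=
  exists A eps : R, [/\ 0 < A, 0 < eps,
    forall y, ~ on_diagonal y -> `|K y| <= A / mutual_dist y ^+ (m * n) &
    forall y (j : 'I_m.+1) (y' : X), ~ on_diagonal y ->
      enorm (y j - y') <= 2^-1 * \big[Num.max/0]_k enorm (y j - y k) ->
      `|K y - K [eta y with j |-> y']| <=
        A * enorm (y j - y') `^ eps / mutual_dist y `^ ((m * n)%:R + eps)].

Definition kernel_integral (K : ('I_m.+1 -> X) -> R) f (x : X) : R :=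
  \int[tuple_measure leb m]_y
    (K (tnth (cons_tuple x y)) * \prod_i f i (tnth y i)).

Definition calderon_zygmund (T : ('I_m -> X -> R) -> (X -> R) -> R) : Prop :=
  [/\ forall f, (forall i, schwartz (f i)) -> tempered_distribution (T f),
      multilinear_on (fun=> @schwartz R n)
        (fun u v => forall phi, schwartz phi -> u phi = v phi) T &
      exists (s_ : 'I_m -> R) (s : R) (B : ('I_m -> X -> R) -> X -> R)
             (K : ('I_m.+1 -> X) -> R),
        [/\ forall i, 1 <= s_ i,
            m%:R^-1 <= s /\ s^-1 = \sum_i (s_ i)^-1,
            bounded_extension (fun=> leb) s_ leb (Lnorm leb s%:E) T B,
            CZ_kernel K &
            forall f, (forall i, test_function (f i)) ->
              {ae leb, forall x, ~ (forall i, supp (f i) x) ->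
                 B f x = kernel_integral K f x}]].

End multilinear_operators.

(* Main.v *)
(* Only the boundedness of the multilinear extension [B] matters. For each [N]
   there are finitely many random variables [th_1, ..., th_N], on a finite
   space, with |sum_k a_k th_k| comparable to (sum_k |a_k|^r)^(1/r): from above
   in L^q for every admissible [q], and from below with probability bounded
   away from 0. If r = 2 these are Rademacher signs. If r < 2 they are
   symmetric discrete Pareto variables with tail exponent [r], the elementary
   substitute for r-stable variables. The lower bound in probability iterates
   over the [m] coordinates, so pointwise the l^r norm of the B(f_k) is at most
   a constant times |sum_k th_k1 ... th_km B(f_k)| = |B(sum th f^1, ..., sum th
   f^m)| with probability bounded below. Integrating this over the space and
   using the operator norm, then the moment upper bounds and the independence
   of the [m] families (with p <= q_i), gives the estimate for [N] functions in
   both the strong and the weak case; then [N] tends to infinity. *)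
Require Import Defs.
From mathcomp Require Import all_boot all_order all_algebra.
From mathcomp Require Import all_classical all_reals all_analysis.
From mathcomp Require Import measurable_realfun ring lra.
Set Implicit Arguments.
Unset Strict Implicit.
Unset Printing Implicit Defensive.
Import Order.TTheory GRing.Theory Num.Theory.
Import numFieldNormedType.Exports.
Local Open Scope classical_set_scope.
Local Open Scope ring_scope.

(** * Anticoncentration of random chaoses *)

(** The lower bound is one in probability, not of a moment, because it then passes through every
    nondecreasing nonnegative [phi]: the integral of [phi] of the l^r norm is controlled by an
    average of integrals of [phi] of a random value of [B]. Taking [phi t = t ^ p] gives the strong
    estimate, also for [p < 1]; the indicator of the ray above [l] gives the weak one, level by
    level. For r < 2 two demands compete. The tail must be so heavy that the largest [a_k th_k]
    alone reaches the size of the l^r norm, yet so light that the moments of order [q] stay bounded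
    uniformly in [N]. A tail of order t^-r meets the first demand, [q < r] keeps the large terms
    under control for the second, and [r < 2] does so for the squares of the moderate terms. On a
    finite space all expectations are finite sums, so multilinearity is invoked finitely often and
    its exceptional sets stay null. This forces a truncation of the Pareto law; with [N + 1] dyadic
    values the total loss over [N] variables is harmless. *)

Definition subprobability (R : realType) (U : finType) (P : U -> R) : Prop :=
  (forall u, 0 <= P u) /\ \sum_u P u <= 1.

Definition anticoncentrated (R : realType) (r c d : R) (N : nat) (U : finType)
    (P : U -> R) (th : 'I_N -> U -> R) : Prop :=
  forall a : 'I_N -> R, d <= \sum_u P u *
    (c * \sum_k `|a k| `^ r <= `|\sum_k a k * th k u| `^ r)%R%:R.

Definition ffun_cons (A : Type) (m : nat) (a : A) (k : {ffun 'I_m -> A}) :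
    {ffun 'I_m.+1 -> A} :=
  [ffun i => oapp k a (unlift ord0 i)].

Lemma ffun_cons0 (A : Type) (m : nat) (a : A) (k : {ffun 'I_m -> A}) :
  ffun_cons a k ord0 = a.
Proof. by rewrite ffunE unlift_none. Qed.

Lemma ffun_consS (A : Type) (m : nat) (a : A) (k : {ffun 'I_m -> A}) i :
  ffun_cons a k (lift ord0 i) = k i.
Proof. by rewrite ffunE liftK. Qed.

Lemma sum_ffun_recl (V : nmodType) (A : finType) (m : nat)
    (F : {ffun 'I_m.+1 -> A} -> V) :
  \sum_k F k = \sum_a \sum_(k : {ffun 'I_m -> A}) F (ffun_cons a k).
Proof.
rewrite pair_big /= (reindex (fun x : A * {ffun 'I_m -> A} => ffun_cons x.1 x.2)) //=.
exists (fun k => (k ord0, [ffun i => k (lift ord0 i)])) => [[a k]|k] _ /=.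
  by rewrite ffun_cons0; congr pair; apply/ffunP => i; rewrite ffunE ffun_consS.
apply/ffunP => i; case: (unliftP ord0 i) => [j|] ->.
  by rewrite ffun_consS ffunE.
by rewrite ffun_cons0.
Qed.

Lemma prod_ffun_recl (R : comRingType) (A : finType) (m : nat) (F : 'I_m.+1 -> A -> R)
    (a : A) (k : {ffun 'I_m -> A}) :
  \prod_i F i (ffun_cons a k i) = F ord0 a * \prod_i F (lift ord0 i) (k i).
Proof.
by rewrite big_ord_recl ffun_cons0; congr (_ * _); apply: eq_bigr => i _; rewrite ffun_consS.
Qed.

Lemma sum_ffun0 (V : nmodType) (A : finType) (F : {ffun 'I_0 -> A} -> V)
    (k0 : {ffun 'I_0 -> A}) : \sum_k F k = F k0.
Proof.
rewrite (bigD1 k0) //= big1 ?addr0 // => k /eqP kk0; case: kk0.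
by apply/ffunP => -[].
Qed.

(* Reverse Markov inequality: among weights [A j], those for which the event
   [E j] occurs carry on average the fraction [d] of the total, hence carry
   at least the fraction [d / 2] with probability at least [d / 2]. *)
Lemma anticoncentration_sum (R : realType) (d : R) (U J : finType) (P : U -> R)
    (A : J -> R) (E : J -> U -> bool) :
  subprobability P -> 0 < d <= \sum_u P u -> (forall j, 0 <= A j) ->
  (forall j, d <= \sum_u P u * (E j u)%:R) ->
  d / 2 <= \sum_u P u * (d / 2 * \sum_j A j <= \sum_j A j * (E j u)%:R)%R%:R.
Proof.
move=> [P0 P1] /andP[d0 dP] A0 dE; set S := \sum_j A j.
have S0 : 0 <= S by apply: sumr_ge0.
have [S00|Sn0] := eqVneq S 0.
  rewrite (@le_trans _ _ (\sum_u P u)) //; first lra.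
  apply: ler_sum => u _; rewrite S00 mulr0 sumr_ge0 ?mulr1 // => j _.
  by rewrite mulr_ge0.
have Sp : 0 < S by rewrite lt_neqAle eq_sym Sn0.
pose Z u := \sum_j A j * (E j u)%:R.
have ZS u : Z u <= S.
  by apply: ler_sum => j _; rewrite ler_piMr // lern1 leq_b1.
have dS : d * S <= \sum_u P u * Z u.
  under [leRHS]eq_bigr do rewrite mulr_sumr.
  rewrite exchange_big mulr_sumr /=; apply: ler_sum => j _.
  under [leRHS]eq_bigr do rewrite mulrCA.
  by rewrite -mulr_sumr mulrC ler_wpM2l.
rewrite -(ler_pM2r Sp) mulr_suml -[leLHS](addrK (d / 2 * S)) lerBlDr.
have -> : d / 2 * S + d / 2 * S = d * S by field.
apply: (le_trans dS).
have : \sum_u P u * (d / 2 * S) <= d / 2 * S.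
  by rewrite -mulr_suml ler_piMl // mulr_ge0 // divr_ge0 // ltW.
move=> h; apply: le_trans (lerD (lexx _) h); rewrite -big_split /=.
apply: ler_sum => u _; rewrite -[X in _ <= X + _]mulrA -mulrDr ler_wpM2l // -/(Z u).
have dS0 : 0 <= d / 2 * S by rewrite mulr_ge0 // divr_ge0 // ltW.
case: (leP (d / 2 * S) (Z u)) => [_|/ltW ZdS].
  by rewrite mul1r; apply: le_trans (ZS u) _; rewrite lerDl.
by rewrite mul0r add0r.
Qed.

Lemma leq_b_imp (a b : bool) : (a -> b) -> (a <= b)%N.
Proof. by case: a; case: b => // ->. Qed.

Lemma anticoncentrated_mass (R : realType) (r c d : R) (N : nat) (U : finType)
    (P : U -> R) (th : 'I_N -> U -> R) :
  subprobability P -> anticoncentrated r c d P th -> d <= \sum_u P u.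
Proof.
move=> [P0 _] /(_ (fun=> 0)) /le_trans; apply; apply: ler_sum => u _.
by rewrite ler_piMr // lern1 leq_b1.
Qed.

(** Conditioning on the first variable [u] leaves a chaos of one order less, with coefficients
    [b u k]. For each [k] a good lower bound on [b u k] has probability at least [d], but there are
    too many [k] for all of them to hold together; [anticoncentration_sum] only asks for a fixed
    fraction of the total weight. Each order costs a factor [c * (d / 2)] in size and [d / 2] in
    probability. *)
Lemma anticoncentration_chaos (R : realType) (r c d : R) (N : nat) (U : finType)
    (P : U -> R) (th : 'I_N -> U -> R) (m : nat) (a : {ffun 'I_m -> 'I_N} -> R) :
  subprobability P -> 0 < c -> 0 < d -> anticoncentrated r c d P th ->
  (d / 2) ^+ m <= \sum_(u : {ffun 'I_m -> U}) (\prod_i P (u i)) *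
    ((c * (d / 2)) ^+ m * \sum_k `|a k| `^ r <=
     `|\sum_k a k * \prod_i th (k i) (u i)| `^ r)%R%:R.
Proof.
move=> PP c0 d0 ac; have [P0 P1] := PP.
have dP : 0 < d <= \sum_u P u by rewrite d0 (anticoncentrated_mass PP ac).
elim: m a => [|m IH] a.
  rewrite expr0 (sum_ffun0 _ (ffun0 (card_ord 0))) big_ord0 expr0 !mul1r.
  pose k0 : {ffun 'I_0 -> 'I_N} := ffun0 (card_ord 0).
  by rewrite !(sum_ffun0 _ k0) big_ord0 mulr1 lexx.
rewrite sum_ffun_recl.
pose b (u : U) (k : {ffun 'I_m -> 'I_N}) := \sum_l a (ffun_cons l k) * th l u.
have := @anticoncentration_sum R d U {ffun 'I_m -> 'I_N} P
  (fun k => \sum_l `|a (ffun_cons l k)| `^ r)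
  (fun k u => c * \sum_l `|a (ffun_cons l k)| `^ r <= `|b u k| `^ r) PP dP.
move=> /(_ (fun k => sumr_ge0 _ (fun l _ => powR_ge0 _ _))).
move=> /(_ (fun k => ac (fun l => a (ffun_cons l k)))) h.
have d20 : 0 < d / 2 by rewrite divr_gt0.
rewrite exprS; apply: (le_trans (ler_wpM2r (exprn_ge0 m (ltW d20)) h)).
rewrite mulr_suml; apply: ler_sum => u _.
under [leRHS]eq_bigr do rewrite (prod_ffun_recl (fun=> P)) -mulrA.
rewrite -mulr_sumr -[leLHS]mulrA ler_wpM2l //.
case: (leP (d / 2 * _)) => [hu|_]; last first.
  rewrite mul0r sumr_ge0 // => v _; rewrite mulr_ge0 //.
  by rewrite prodr_ge0.
rewrite mul1r; apply: (le_trans (IH (b u))); apply: ler_sum => v _.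
rewrite ler_wpM2l ?prodr_ge0 // ler_nat; apply: leq_b_imp => hb.
have -> : \sum_k a k * \prod_i th (k i) (ffun_cons u v i) =
          \sum_k b u k * \prod_i th (k i) (v i).
  rewrite sum_ffun_recl exchange_big; apply: eq_bigr => k _.
  rewrite mulr_suml; apply: eq_bigr => l _.
  rewrite -mulrA; congr (_ * _); rewrite big_ord_recl !ffun_cons0.
  by congr (_ * _); apply: eq_bigr => i _; rewrite !ffun_consS.
(* Only the indices [k] whose event occurs are kept: they carry at least the fraction [d / 2] of the
   total, and each keeps the factor [c]. *)
apply: le_trans _ hb.
rewrite exprSr -mulrA ler_wpM2l ?exprn_ge0 ?(mulr_ge0 (ltW c0) (ltW d20)) //.
rewrite sum_ffun_recl exchange_big -[leLHS]mulrA /=.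
apply: le_trans (ler_wpM2l (ltW c0) hu) _; rewrite mulr_sumr.
apply: ler_sum => k _; case: (leP (c * \sum_l _)) => [h1|_]; first by rewrite mulr1.
by rewrite mulr0 mulr0 powR_ge0.
Qed.

(** * Rademacher sums *)

Definition rademacher_sum (R : realType) (N : nat) (c : 'I_N -> R)
    (s : {ffun 'I_N -> bool}) : R :=
  \sum_k c k * (-1) ^+ s k.

Definition rademacher_prob (R : realType) (N : nat) (s : {ffun 'I_N -> bool}) : R :=
  2^-1 ^+ N.

Definition flip_sign (N : nat) (k : 'I_N) (s : {ffun 'I_N -> bool}) :
    {ffun 'I_N -> bool} :=
  [ffun i => (i == k) (+) s i].

Lemma flip_signK (N : nat) (k : 'I_N) : involutive (flip_sign k).
Proof. by move=> s; apply/ffunP => i; rewrite !ffunE addbA addbb addFb. Qed.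

Lemma sum_flip_sign (V : nmodType) (N : nat) (k : 'I_N)
    (F : {ffun 'I_N -> bool} -> V) :
  \sum_s F s = \sum_s F (flip_sign k s).
Proof. by rewrite (reindex_inj (can_inj (@flip_signK N k))). Qed.

Lemma rademacher_prob_mass (R : realType) (N : nat) :
  \sum_(s : {ffun 'I_N -> bool}) rademacher_prob R s = 1.
Proof.
rewrite sumr_const card_ffun card_bool card_ord -[LHS]mulr_natr natrX -exprMn.
by rewrite mulVf ?expr1n // pnatr_eq0.
Qed.

Lemma rademacher_prob_gt0 (R : realType) (N : nat) (s : {ffun 'I_N -> bool}) :
  0 < rademacher_prob R s.
Proof. by rewrite exprn_gt0 // invr_gt0 ltr0n. Qed.

Lemma rademacher_sum_flip (R : realType) (N : nat) (c : 'I_N -> R) k s :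
  rademacher_sum c (flip_sign k s) = rademacher_sum c s - 2 * c k * (-1) ^+ s k.
Proof.
rewrite /rademacher_sum (bigD1 k) //= [in RHS](bigD1 k) //= ffunE eqxx addTb.
rewrite (eq_bigr (fun i => c i * (-1) ^+ s i)); last first.
  by move=> i /negPf ik; rewrite ffunE ik addFb.
by rewrite signrN; ring.
Qed.

(** Flipping the sign of index [k] moves the sum by [2 * |c k|], so of two paired sign patterns at
    least one gives a sum of absolute value at least [|c k|]. *)
Lemma rademacher_sum_large (R : realType) (N : nat) (c : 'I_N -> R) k :
  2^-1 <= \sum_s rademacher_prob R s * (`|c k| <= `|rademacher_sum c s|)%R%:R.
Proof.
set A := \sum_s _; suff : 1 <= A + A by lra.
rewrite {2}/A (sum_flip_sign k) -big_split -[leLHS](rademacher_prob_mass R N) /=.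
apply: ler_sum => s _; rewrite -mulrDr ler_peMr ?(ltW (rademacher_prob_gt0 _ _)) //.
rewrite -natrD ler1n; case: leP => // h1; case: leP => // h2; exfalso.
suff : 2 * `|c k| < 2 * `|c k| by rewrite ltxx.
have e : `|rademacher_sum c s - rademacher_sum c (flip_sign k s)| = 2 * `|c k|.
  by rewrite rademacher_sum_flip opprB addrC subrK !normrM normr_sign mulr1 normr_nat.
by rewrite -{1}e; apply: le_lt_trans (ler_normB _ _) _; lra.
Qed.

Lemma rademacher_sum_sqr (R : realType) (N : nat) (c : 'I_N -> R) :
  \sum_s rademacher_prob R s * rademacher_sum c s ^+ 2 = \sum_k c k ^+ 2.
Proof.
under eq_bigr => s _.
  rewrite expr2 {1}/rademacher_sum mulr_suml mulr_sumr.
  under eq_bigr do rewrite mulr_sumr mulr_sumr.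
  over.
rewrite exchange_big; apply: eq_bigr => k _.
rewrite exchange_big (bigD1 k) //= [X in _ + X]big1 ?addr0 => [|l lk].
  under eq_bigr do rewrite [X in _ * X]mulrACA -!expr2 sqrr_sign mulr1.
  by rewrite -mulr_suml rademacher_prob_mass mul1r.
(* A cross term [k != l] changes sign under the flip of [k]. *)
set S := \sum_s _; suff : S = - S by move=> h; lra.
rewrite {1}/S (sum_flip_sign k) -sumrN; apply: eq_bigr => s _.
rewrite !ffunE eqxx (negPf lk) addTb addFb signrN.
by rewrite -/(rademacher_prob R s) /rademacher_prob; ring.
Qed.

Lemma rademacher_prod (R : realType) (N : nat) (F : 'I_N -> bool -> R) :
  \sum_(s : {ffun 'I_N -> bool}) rademacher_prob R s * \prod_k F k (s k) =
  \prod_k ((F k false + F k true) / 2).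
Proof.
have -> : \prod_k ((F k false + F k true) / 2) =
          \prod_k \sum_(b : bool) (F k b / 2).
  by apply: eq_bigr => k _; rewrite big_bool addrC mulrDl.
rewrite bigA_distr_bigA; apply: eq_bigr => s _.
by rewrite big_split prodr_const card_ord /= mulrC.
Qed.

Lemma expR_le_quadratic (R : realType) (x : R) : `|x| <= 2^-1 ->
  expR x <= 1 + x + 2 * x ^+ 2.
Proof.
move=> x2; have [xa xb] : - 2^-1 <= x /\ x <= 2^-1.
  by apply/andP; rewrite -ler_norml.
have e1 := expR_ge1Dx (- x); have x0 : 0 < 1 - x by lra.
have : expR x <= (1 - x)^-1.
  by rewrite -[x in expR x]opprK expRN lef_pV2 // posrE ?expR_gt0.
move=> /le_trans; apply; rewrite -[leLHS]mul1r ler_pdivrMr //; nra.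
Qed.

(** Subgaussian bound: averaging over a sign kills the linear term of [expR_le_quadratic] and leaves
    [1 + 2 * c k ^+ 2]. *)
Lemma rademacher_exp (R : realType) (N : nat) (c : 'I_N -> R) :
  (forall k, `|c k| <= 2^-1) ->
  \sum_s rademacher_prob R s * expR (rademacher_sum c s) <=
  expR (2 * \sum_k c k ^+ 2).
Proof.
move=> c2; under eq_bigr do rewrite expR_sum.
rewrite (rademacher_prod (fun k b => expR (c k * (-1) ^+ b))).
rewrite mulr_sumr expR_sum; apply: ler_prod => k _.
rewrite expr0 expr1 mulr1 mulrN1 divr_ge0 ?addr_ge0 ?expR_ge0 //=.
have h1 := expR_le_quadratic (c2 k).
have := @expR_le_quadratic R (- c k); rewrite normrN sqrrN => /(_ (c2 k)) h2.
apply: le_trans (expR_ge1Dx _); lra.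
Qed.

(** Raise [x / q <= expR (x / q)] to the power [q]. *)
Lemma powR_le_expR (R : realType) (x q : R) : 0 <= x -> 0 < q ->
  x `^ q <= q `^ q * expR x.
Proof.
move=> x0 q0; have xq : 0 <= x / q by rewrite divr_ge0 // ltW.
rewrite -[in leRHS](divfK (lt0r_neq0 q0) x) expRM -powRM ?expR_ge0 ?(ltW q0) //.
have xe : x <= q * expR (x / q).
  by rewrite mulrC -ler_pdivrMr //; have := expR_ge1Dx (x / q); lra.
by rewrite ge0_ler_powR ?nnegrE ?(le_trans x0 xe) ?(ltW q0).
Qed.

(* An exponent [q] need not be an integer, so the moments are bounded by
   exponential moments of the sum normalised to have variance 1/4. *)
Lemma rademacher_moment (R : realType) (q : R) : 0 < q ->
  exists2 K : R, 0 < K & forall (N : nat) (c : 'I_N -> R),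
    \sum_s rademacher_prob R s * `|rademacher_sum c s| `^ q <=
    K * (\sum_k c k ^+ 2) `^ (q / 2).
Proof.
move=> q0; exists (2 `^ q * (q `^ q * (2 * expR 2^-1))) => [|N c].
  by rewrite !mulr_gt0 ?powR_gt0 ?expR_gt0.
set A := \sum_k c k ^+ 2; have A0 : 0 <= A by apply: sumr_ge0 => k _; exact: sqr_ge0.
have [A00|An0] := eqVneq A 0.
  rewrite big1 ?mulr_ge0 ?powR_ge0 ?expR_ge0 // => s _.
  rewrite /rademacher_sum big1 ?normr0 ?powR0 ?mulr0 ?gt_eqF // => k _.
  have /(_ k isT)/eqP := psumr_eq0P (fun i _ => sqr_ge0 (c i)) A00.
  by rewrite sqrf_eq0 => /eqP ->; rewrite mul0r.
have Ap : 0 < A by rewrite lt_neqAle eq_sym An0.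
pose t := Num.sqrt A; have t0 : 0 < t by rewrite sqrtr_gt0.
have tA : t ^+ 2 = A by rewrite sqr_sqrtr.
(* With squares summing to 1/4, each coefficient is at most 1/2, as [rademacher_exp] requires. *)
pose b k := c k / (2 * t).
have b2 : \sum_k b k ^+ 2 = 4^-1.
  under eq_bigr do rewrite expr_div_n.
  by rewrite -mulr_suml -/A exprMn tA; field.
have bk k : `|b k| <= 2^-1.
  rewrite -(@ler_pXn2r _ 2) ?nnegrE ?invr_ge0 // real_normK ?num_real //.
  have -> : 2^-1 ^+ 2 = \sum_k b k ^+ 2 :> R by rewrite b2; field.
  by rewrite (bigD1 k) //= lerDl sumr_ge0 // => i _; exact: sqr_ge0.
have rsE s : rademacher_sum c s = 2 * t * rademacher_sum b s.
  rewrite /rademacher_sum mulr_sumr; apply: eq_bigr => k _.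
  by rewrite mulrA mulrCA divff ?mulr1 // mulf_neq0 ?gt_eqF.
have eb (d : R) : `|d| = 1 ->
    \sum_s rademacher_prob R s * expR (d * rademacher_sum b s) <= expR 2^-1.
  move=> d1; have dE s : d * rademacher_sum b s = rademacher_sum (fun k => d * b k) s.
    by rewrite /rademacher_sum mulr_sumr; apply: eq_bigr => k _; rewrite mulrA.
  under eq_bigr do rewrite dE.
  apply: le_trans (rademacher_exp _) _ => [k|]; first by rewrite normrM d1 mul1r.
  under eq_bigr do rewrite exprMn -[d ^+ 2]real_normK ?num_real // d1 expr1n mul1r.
  by rewrite b2 ler_expR; lra.
have tq : (2 * t) `^ q = 2 `^ q * A `^ (q / 2).
  rewrite powRM ?ltW // -tA; congr (_ * _).
  by rewrite -powR_mulrn ?ltW // -powRrM mulrC divfK.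
have step s : `|rademacher_sum c s| `^ q <= 2 `^ q * A `^ (q / 2) * (q `^ q *
    (expR (1 * rademacher_sum b s) + expR (-1 * rademacher_sum b s))).
  rewrite rsE normrM powRM // (gtr0_norm (mulr_gt0 _ t0)) // tq.
  rewrite ler_wpM2l ?mulr_ge0 ?powR_ge0 //.
  apply: le_trans (powR_le_expR (normr_ge0 _) q0) _.
  rewrite ler_wpM2l ?powR_ge0 // mul1r mulN1r.
  by case: (ger0P (rademacher_sum b s)) => _; rewrite ?lerDl ?lerDr expR_ge0.
apply: (@le_trans _ _ (\sum_s 2 `^ q * A `^ (q / 2) * (q `^ q *
    (rademacher_prob R s * expR (1 * rademacher_sum b s) +
     rademacher_prob R s * expR (-1 * rademacher_sum b s))))).
  apply: ler_sum => s _; apply: le_trans (ler_wpM2l _ (step s)) _.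
    exact: ltW (rademacher_prob_gt0 _ _).
  by rewrite le_eqVlt; apply/orP; left; apply/eqP; ring.
rewrite -!mulr_sumr big_split /= [leRHS](_ : _ = 2 `^ q * A `^ (q / 2) *
  (q `^ q * (expR 2^-1 + expR 2^-1))); last by ring.
rewrite ler_wpM2l ?mulr_ge0 ?powR_ge0 // ler_wpM2l ?powR_ge0 //.
by rewrite lerD ?eb ?normrN ?normr1.
Qed.

(** Paley-Zygmund inequality for the square of the sum: its second moment is at most a constant
    times the square of its mean, so its mean cannot come from rare large values. *)
Lemma rademacher_anticoncentration (R : realType) :
  exists2 d : R, 0 < d & forall (N : nat) (c : 'I_N -> R),
    d <= \sum_s rademacher_prob R s *
      (2^-1 * \sum_k c k ^+ 2 <= rademacher_sum c s ^+ 2)%R%:R.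
Proof.
have [K K0 hK] := @rademacher_moment R 4 ltac:(by []).
(* The entry [1] serves vanishing coefficients, where the event is certain. In general the losses
   [A / 2] and [A / 4] leave [A / 4 <= K * A * W], whence [(4 * K)^-1]. *)
exists (Num.min 1 (4 * K)^-1) => [|N c].
  by rewrite lt_min ltr01 invr_gt0 mulr_gt0.
have P0 s := ltW (@rademacher_prob_gt0 R N s).
set A := \sum_k c k ^+ 2; have A0 : 0 <= A by apply: sumr_ge0 => k _; exact: sqr_ge0.
have [->|An0] := eqVneq A 0.
  under eq_bigr do rewrite mulr0 sqr_ge0 mulr1.
  by rewrite rademacher_prob_mass ge_min lexx.
have Ap : 0 < A by rewrite lt_neqAle eq_sym An0.
rewrite ge_min; apply/orP; right.
set W := \sum_s _.
have m4 : \sum_s rademacher_prob R s * rademacher_sum c s ^+ 4 <= K * A ^+ 2.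
  have := hK N c; rewrite (_ : 4 / 2 = 2%:R); last by field.
  rewrite powR_mulrn //; under eq_bigr do
    rewrite powR_mulrn // -(normrX 4) ger0_norm ?exprn_even_ge0 //.
  by [].
have m2 := rademacher_sum_sqr c; rewrite -/A in m2.
have KA0 : 0 <= 4 * K * A by rewrite !mulr_ge0 // ltW.
(* AM-GM: [x <= A / 2 + (x ^+ 2 / A / (4 * K)) + K * A * [A / 2 <= x]] *)
have step s : rademacher_sum c s ^+ 2 <= A / 2 + rademacher_sum c s ^+ 4 / (4 * K * A)
    + K * A * (2^-1 * A <= rademacher_sum c s ^+ 2)%R%:R.
  case: (leP (2^-1 * A)) => hx; last first.
    rewrite mulr0 addr0; apply: (@le_trans _ _ (A / 2)); first lra.
    by rewrite lerDl divr_ge0 ?exprn_even_ge0.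
  set x := rademacher_sum c s ^+ 2 in hx *.
  rewrite mulr1 (_ : rademacher_sum c s ^+ 4 = x ^+ 2); last by rewrite -exprM.
  rewrite -addrA ler_wpDl ?divr_ge0 //.
  rewrite -subr_ge0 (_ : _ - x = (x - 2 * K * A) ^+ 2 / (4 * K * A)).
    by rewrite divr_ge0 ?sqr_ge0.
  by field; rewrite !gt_eqF.
have : A <= A / 2 + K * A ^+ 2 / (4 * K * A) + K * A * W.
  rewrite -[leLHS]m2; apply: (@le_trans _ _ (\sum_s (rademacher_prob R s * (A / 2)
     + rademacher_prob R s * rademacher_sum c s ^+ 4 / (4 * K * A)
     + K * A * (rademacher_prob R s *
         (2^-1 * A <= rademacher_sum c s ^+ 2)%R%:R)))).
    apply: ler_sum => s _; apply: le_trans (ler_wpM2l (P0 s) (step s)) _.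
    by rewrite le_eqVlt; apply/orP; left; apply/eqP; ring.
  rewrite !big_split /= -!mulr_suml -[X in _ + X <= _]mulr_sumr rademacher_prob_mass mul1r.
  by rewrite !lerD // ler_wpM2r // invr_ge0.
have -> : K * A ^+ 2 / (4 * K * A) = A / 4 by field; rewrite !gt_eqF.
move=> h; rewrite -[leLHS]mul1r ler_pdivrMr ?mulr_gt0 //.
by rewrite -(ler_pM2r Ap); lra.
Qed.

(** * Pareto sums *)

Lemma product_marginal (R : realType) (N : nat) (T : finType) (w : T -> R)
    (k : 'I_N) (g : T -> R) : \sum_t w t = 1 ->
  \sum_(j : {ffun 'I_N -> T}) (\prod_i w (j i)) * g (j k) = \sum_t w t * g t.
Proof.
move=> w1; pose F i t := w t * (if i == k then g t else 1).
transitivity (\sum_(j : {ffun 'I_N -> T}) \prod_i F i (j i)).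
  apply: eq_bigr => j _; rewrite /F big_split /=; congr (_ * _).
  by rewrite -big_mkcond big_pred1_eq.
rewrite -bigA_distr_bigA (bigD1 k) //= [X in _ * X]big1 ?mulr1 => [|i ik].
  by apply: eq_bigr => t _; rewrite /F eqxx.
by rewrite -[RHS]w1; apply: eq_bigr => t _; rewrite /F (negPf ik) mulr1.
Qed.

Lemma product_mass (R : realType) (N : nat) (T : finType) (w : T -> R) :
  \sum_t w t = 1 -> \sum_(j : {ffun 'I_N -> T}) \prod_i w (j i) = 1.
Proof.
by move=> w1; rewrite -(bigA_distr_bigA (fun i => w)) big1.
Qed.

(** By independence none of the events occurs with probability [\prod_k (1 - p_k)], and
    [1 - p_k <= expR (- p_k)]. *)
Lemma product_union (R : realType) (N : nat) (T : finType) (w : T -> R)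
    (E : 'I_N -> T -> bool) : (forall t, 0 <= w t) -> \sum_t w t = 1 ->
  1 - expR (- \sum_k \sum_t w t * (E k t)%:R) <=
  \sum_(j : {ffun 'I_N -> T}) (\prod_i w (j i)) * [exists k, E k (j k)]%:R.
Proof.
move=> w0 w1.
have -> : \sum_(j : {ffun 'I_N -> T}) (\prod_i w (j i)) * [exists k, E k (j k)]%:R =
    1 - \sum_(j : {ffun 'I_N -> T}) \prod_i (w (j i) * (~~ E i (j i))%:R).
  rewrite -[X in _ = X - _](product_mass N w1) -sumrB; apply: eq_bigr => j _.
  rewrite big_split /= -[X in _ = X - _]mulr1 -mulrBr; congr (_ * _).
  case: existsP => [[k Ek]|nE].
    by rewrite (bigD1 k) //= Ek mul0r subr0.
  rewrite big1 ?subrr // => k _; case: (boolP (E k (j k))) => // Ek.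
  by case: nE; exists k.
rewrite lerD2l lerN2.
have <- : \prod_i \sum_t w t * (~~ E i t)%:R =
    \sum_(j : {ffun 'I_N -> T}) \prod_i (w (j i) * (~~ E i (j i))%:R).
  by rewrite bigA_distr_bigA.
rewrite -sumrN expR_sum; apply: ler_prod => k _.
rewrite sumr_ge0 => [|t _]; last by rewrite mulr_ge0.
apply: le_trans (expR_ge1Dx _); rewrite -[X in _ <= X + _]w1 -sumrB.
apply: ler_sum => t _; case: (E k t); rewrite ?mulr0 ?mulr1; have := w0 t; lra.
Qed.

(** * Dyadic laws with tail of order 1/t: tails and truncated moments *)

Definition dyadic_sum (R : realType) (g : R -> R) (L : nat) (b : R) : R :=
  \sum_(j < L) 2^-1 ^+ j.+1 * g (b * 2 ^+ j).

(** Self-similarity: removing the smallest value of the law leaves a copy with half the mass on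
    values twice as large. The two estimates below are inductions along this identity, with [b]
    doubling at each step. *)
Lemma dyadic_sumS (R : realType) (g : R -> R) (L : nat) (b : R) :
  dyadic_sum g L.+1 b = 2^-1 * g b + 2^-1 * dyadic_sum g L (2 * b).
Proof.
rewrite /dyadic_sum big_ord_recl expr0 mulr1 expr1; congr (_ + _).
rewrite mulr_sumr; apply: eq_bigr => j _; rewrite mulrA -exprS; congr (_ * g _).
by rewrite /= /bump /= add1n exprS mulrA (mulrC b).
Qed.

(** Doubling [b] until it reaches 1/2 preserves the bound; from there on the first value alone
    suffices. The subtracted term is the price of the truncation to [L] values. *)
Lemma dyadic_sum_tail (R : realType) (L : nat) (b : R) : 0 <= b <= 1 ->
  b / 2 - 2^-1 ^+ L / 2 <= dyadic_sum (fun x => (2^-1 <= x)%R%:R) L b.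
Proof.
elim: L b => [|L IH] b /andP[b0 b1].
  by rewrite /dyadic_sum big_ord0 expr0; lra.
rewrite dyadic_sumS exprS; have e0 : 0 <= 2^-1 ^+ L :> R by rewrite exprn_ge0.
case: (leP 2^-1 b) => b2.
  have : 0 <= dyadic_sum (fun x : R => (2^-1 <= x)%R%:R) L (2 * b).
    by apply: sumr_ge0 => j _; rewrite mulr_ge0 // exprn_ge0.
  by rewrite mulr1; lra.
have /IH : 0 <= 2 * b <= 1 by apply/andP; split; lra.
by rewrite mulr0; lra.
Qed.

(** Heuristically the sum compares to [b] times the integral of [Num.min (t ^ al) (t ^ be)] against
    [t ^ -2], which converges at 0 because [1 < al] and at infinity because [be < 1]. *)
Lemma dyadic_sum_moment (R : realType) (al be : R) : 0 < be < 1 -> 1 < al ->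
  exists2 C : R, 0 < C & forall L b, 0 <= b <= 1 ->
    dyadic_sum (fun x => Num.min (x `^ al) (x `^ be)) L b <= C * b.
Proof.
move=> /andP[be0 be1] al1; pose g := fun x : R => Num.min (x `^ al) (x `^ be); rewrite -/g.
have al0 : 0 < al by lra.
have two1 : 1 < 2 :> R by lra.
have b1 : 2 `^ be < 2 :> R.
  by rewrite -[ltRHS]powRr1 // /powR gt_eqF // ltr_expR ltr_pM2r // ln_gt0.
have a1 : 2 < 2 `^ al :> R.
  by rewrite -[ltLHS]powRr1 // /powR gt_eqF // ltr_expR ltr_pM2r // ln_gt0.
(* [C1] sums the series of [2^-1 ^+ j.+1 * 2 ^ (j * be)]; [D] is solved so that the negative term of
   [claim2] reproduces itself when [b] doubles. *)
pose C1 := (2 - 2 `^ be)^-1 : R.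
pose D := (2 `^ al - 2)^-1 : R.
have C10 : 0 < C1 by rewrite invr_gt0 subr_gt0.
have D0 : 0 < D by rewrite invr_gt0 subr_gt0.
have C1E : C1 * (2 - 2 `^ be) = 1 by rewrite mulVf // gt_eqF // subr_gt0.
have DE : D * (2 `^ al - 2) = 1 by rewrite mulVf // gt_eqF // subr_gt0.
have claim1 L b : 0 <= b -> dyadic_sum g L b <= C1 * b `^ be.
  elim: L b => [|L IH] b b0.
    by rewrite /dyadic_sum big_ord0 mulr_ge0 ?powR_ge0 // ltW.
  have /IH : 0 <= 2 * b by lra.
  rewrite dyadic_sumS powRM // => h.
  have : g b <= b `^ be by rewrite ge_min lexx orbT.
  have := powR_ge0 b be; set y := b `^ be in h *; nra.
(* The subtracted [D * b ^ al] pays for the terms [g b <= b ^ al] as long as [b <= 1 / 2]; beyond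
   that [claim1] takes over. *)
have claim2 L b : 0 <= b <= 1 ->
    dyadic_sum g L b <= (2^-1 + C1 + D) * b - D * b `^ al.
  elim: L b => [|L IH] b /andP[b0 b1'].
    have bal : b `^ al <= b.
      have [->|bn0] := eqVneq b 0; first by rewrite powR0 // gt_eqF.
      by rewrite ge1r_powR ?(ltW al1) // b1' lt_neqAle eq_sym bn0 b0.
    rewrite /dyadic_sum big_ord0; nra.
  rewrite dyadic_sumS; have gb : g b <= b `^ al by rewrite ge_min lexx.
  have [b2|b2] := leP b 2^-1.
    have /IH : 0 <= 2 * b <= 1 by apply/andP; split; lra.
    rewrite powRM // => h; have : D * (2 `^ al - 2) * b `^ al = b `^ al.
      by rewrite DE mul1r.
    lra.
  have bal : b `^ al <= b by rewrite ge1r_powR ?(ltW al1) // b1' andbT; lra.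
  have b20 : 0 <= 2 * b by lra.
  have : (2 * b) `^ be <= 2 * b by rewrite ler1_powR ?(ltW be1) //; lra.
  have := claim1 L (2 * b) b20; nra.
exists (2^-1 + C1 + D) => [|L b bb]; first by rewrite !addr_gt0.
apply: le_trans (claim2 L b bb) _.
by rewrite lerBlDr lerDl mulr_ge0 ?powR_ge0 // ltW.
Qed.

(** * Homogeneity: reduction to coefficients of unit l^r norm *)

Lemma sum_powR_eq0 (R : realType) (r : R) (N : nat) (a : 'I_N -> R) (k : 'I_N) :
  \sum_k `|a k| `^ r = 0 -> a k = 0.
Proof.
move=> /(psumr_eq0P (fun i _ => powR_ge0 _ _)) /(_ k isT) /powR_eq0_eq0 /eqP.
by rewrite normr_eq0 => /eqP.
Qed.

Lemma lr_normalize (R : realType) (r : R) (N : nat) (a : 'I_N -> R) :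
  0 < r -> 0 < \sum_k `|a k| `^ r ->
  exists2 t : R, 0 < t & t `^ r = \sum_k `|a k| `^ r /\
    exists2 b : 'I_N -> R, \sum_k `|b k| `^ r = 1 & forall k, a k = t * b k.
Proof.
move=> r0 A0; set A := \sum_k _ in A0 *.
have t0 : 0 < A `^ r^-1 by rewrite powR_gt0.
have tA : (A `^ r^-1) `^ r = A by rewrite -powRrM mulVf ?powRr1 ?ltW // gt_eqF.
exists (A `^ r^-1) => //; split=> //.
exists (fun k => a k / A `^ r^-1) => [|k]; last by rewrite mulrC divfK ?gt_eqF.
under eq_bigr do rewrite normrM powRM // (gtr0_norm (x := (A `^ r^-1)^-1)) ?invr_gt0 //.
by rewrite -mulr_suml -powR_inv1 ?(ltW t0) // -powRrM mulN1r powRN tA divff ?gt_eqF.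
Qed.

Lemma normalized_anticoncentrated (R : realType) (r c d : R) (N : nat)
    (U : finType) (P : U -> R) (th : 'I_N -> U -> R) : 0 < r -> d <= \sum_u P u ->
  (forall a : 'I_N -> R, \sum_k `|a k| `^ r = 1 ->
    d <= \sum_u P u * (c <= `|\sum_k a k * th k u| `^ r)%R%:R) ->
  anticoncentrated r c d P th.
Proof.
move=> r0 dP h a.
have [A0|An0] := eqVneq (\sum_k `|a k| `^ r) 0.
  by under eq_bigr do rewrite A0 mulr0 powR_ge0 mulr1.
have Ap : 0 < \sum_k `|a k| `^ r.
  by rewrite lt_neqAle eq_sym An0 sumr_ge0 // => k _; exact: powR_ge0.
have [t t0 [<- [b b1 ab]]] := lr_normalize r0 Ap.
apply: le_trans (h b b1) _; rewrite le_eqVlt; apply/orP; left; apply/eqP.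
apply: eq_bigr => u _; congr (_ * (nat_of_bool _)%:R).
have -> : \sum_k a k * th k u = t * \sum_k b k * th k u.
  by rewrite mulr_sumr; apply: eq_bigr => k _; rewrite ab mulrA.
by rewrite normrM powRM // (gtr0_norm t0) mulrC ler_pM2l // powR_gt0.
Qed.

Lemma normalized_moment (R : realType) (r q K : R) (N : nat)
    (U : finType) (P : U -> R) (th : 'I_N -> U -> R) : 0 < r -> 0 < q -> 0 <= K ->
  (forall a : 'I_N -> R, \sum_k `|a k| `^ r = 1 ->
    \sum_u P u * `|\sum_k a k * th k u| `^ q <= K) ->
  forall a, \sum_u P u * `|\sum_k a k * th k u| `^ q <=
    K * (\sum_k `|a k| `^ r) `^ (q / r).
Proof.
move=> r0 q0 K0 h a.
have [A0|An0] := eqVneq (\sum_k `|a k| `^ r) 0.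
  rewrite big1 ?mulr_ge0 ?powR_ge0 // => u _.
  rewrite big1 ?normr0 ?powR0 ?gt_eqF ?mulr0 // => k _.
  by rewrite (sum_powR_eq0 k A0) mul0r.
have Ap : 0 < \sum_k `|a k| `^ r.
  by rewrite lt_neqAle eq_sym An0 sumr_ge0 // => k _; exact: powR_ge0.
have [t t0 [<- [b b1 ab]]] := lr_normalize r0 Ap.
have -> : (t `^ r) `^ (q / r) = t `^ q by rewrite -powRrM mulrC divfK ?gt_eqF.
rewrite -ler_pdivrMr ?powR_gt0 // mulr_suml; apply: le_trans (h b b1).
apply: ler_sum => u _.
have -> : \sum_k a k * th k u = t * \sum_k b k * th k u.
  by rewrite mulr_sumr; apply: eq_bigr => k _; rewrite ab mulrA.
rewrite normrM powRM // (gtr0_norm t0) mulrCA mulrAC divff ?mul1r //.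
by rewrite gt_eqF // powR_gt0.
Qed.

(** The fractions [x / (x + y)] and [y / (x + y)] add up to 1 and do not decrease when raised to a
    power [s <= 1]. *)
Lemma powR_subadditive (R : realType) (x y s : R) : 0 <= x -> 0 <= y -> s <= 1 ->
  0 < s -> (x + y) `^ s <= x `^ s + y `^ s.
Proof.
move=> x0 y0 s1 s0; have [xy0|] := eqVneq (x + y) 0.
  by rewrite xy0 powR0 ?gt_eqF // addr_ge0 ?powR_ge0.
move=> xyn0; have xy : 0 < x + y by rewrite lt_neqAle eq_sym xyn0 addr_ge0.
have frac z : 0 <= z <= x + y -> z / (x + y) <= z `^ s / (x + y) `^ s.
  move=> /andP[z0 zxy].
  have -> : z `^ s / (x + y) `^ s = (z / (x + y)) `^ s.
    rewrite powRM ?invr_ge0 ?(ltW xy) //; congr (_ * _).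
    by rewrite -[in RHS]powR_inv1 ?(ltW xy) // -powRrM mulN1r powRN.
  have [->|zn0] := eqVneq z 0; first by rewrite mul0r powR_ge0.
  have zp : 0 < z by rewrite lt_neqAle eq_sym zn0.
  by apply: ger1_powR => //; rewrite divr_gt0 //= ler_pdivrMr ?mul1r.
rewrite -[leLHS]mul1r -ler_pdivlMr ?powR_gt0 // mulrDl.
rewrite -(divff xyn0) mulrDl; apply: lerD; apply: frac.
  by rewrite x0 lerDl.
by rewrite y0 lerDr.
Qed.

(** Separates moderate terms, which enter linearly, from large ones, which enter through their power
    [s]. Applied to squares of Pareto terms, this produces the two exponents of
    [dyadic_sum_moment]. *)
Lemma powR_sum_le (R : realType) (s : R) (N : nat) (y : 'I_N -> R) :
  0 < s <= 1 -> (forall k, 0 <= y k) ->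
  (\sum_k y k) `^ s <= 1 + \sum_k Num.min (y k) (y k `^ s).
Proof.
move=> /andP[s0 s1] y0; set S := \sum_k Num.min _ _.
(* The 1 is put inside the power for the induction: the base stays at least 1, where adding [y k]
   raises the power by at most [y k]. The other bound on the increment is subadditivity. *)
suff [_ h] : 0 <= \sum_k y k /\ (1 + \sum_k y k) `^ s <= 1 + S.
  apply: le_trans h; rewrite ge0_ler_powR ?nnegrE ?(ltW s0) ?addr_ge0 ?sumr_ge0 //.
  by rewrite lerDr.
rewrite /S; elim/big_rec2 : _ => [|k a b _ [b0 h]].
  by rewrite !addr0 powR1.
split; first by rewrite addr_ge0.
have b1 : 1 <= 1 + b by rewrite lerDl.
have bp : 0 < 1 + b by rewrite (lt_le_trans ltr01).
have -> : 1 + (y k + b) = (1 + b) + y k by ring.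
rewrite addrCA [leRHS]addrC.
apply: le_trans (_ : (1 + b) `^ s + Num.min (y k) (y k `^ s) <= _); last by rewrite lerD2r.
rewrite -lerBlDl le_min !lerBlDl powR_subadditive ?(ltW bp) // andbT.
have -> : 1 + b + y k = (1 + b) * (1 + y k / (1 + b)).
  by rewrite mulrDr mulr1 mulrC divfK ?gt_eqF.
have yb0 : 0 <= y k / (1 + b) by rewrite divr_ge0 ?(ltW bp).
rewrite powRM ?(ltW bp) ?addr_ge0 //.
apply: (@le_trans _ _ ((1 + b) `^ s * (1 + y k / (1 + b)))).
  by rewrite ler_wpM2l ?powR_ge0 // ler1_powR // lerDl.
rewrite mulrDr mulr1 lerD2l mulrCA ler_piMr // -/(_ / _).
by rewrite ler_pdivrMr // mul1r ler1_powR.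
Qed.

(* A discrete Pareto law: the value [2 ^ (j / r)] is taken with probability
   [2 ^ -(j + 1)] for [j < L], and the remaining mass sits at [0]. The value
   [2 ^ j] is its [r]-th power. *)
Definition pareto_prob (R : realType) (L : nat) (o : 'I_L.+1) : R :=
  if unlift ord0 o is Some j then 2^-1 ^+ j.+1 else 2^-1 ^+ L.

Definition pareto_pow (R : realType) (L : nat) (o : 'I_L.+1) : R :=
  if unlift ord0 o is Some j then 2 ^+ j else 0.

Lemma pareto_prob_ge0 (R : realType) (L : nat) (o : 'I_L.+1) :
  0 <= pareto_prob R o.
Proof. by rewrite /pareto_prob; case: unlift => [j|]; rewrite exprn_ge0. Qed.

Lemma pareto_pow_ge0 (R : realType) (L : nat) (o : 'I_L.+1) :
  0 <= pareto_pow R o.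
Proof. by rewrite /pareto_pow; case: unlift => [j|] //; rewrite exprn_ge0. Qed.

Lemma pareto_sum (R : realType) (L : nat) (g : R -> R) (b : R) :
  \sum_(o : 'I_L.+1) pareto_prob R o * g (b * pareto_pow R o) =
  2^-1 ^+ L * g 0 + dyadic_sum g L b.
Proof.
rewrite big_ord_recl /pareto_prob /pareto_pow unlift_none mulr0; congr (_ + _).
by apply: eq_bigr => j _; rewrite liftK.
Qed.

Lemma pareto_prob_mass (R : realType) (L : nat) :
  \sum_(o : 'I_L.+1) pareto_prob R o = 1.
Proof.
have := @pareto_sum R L (fun=> 1) 0; under eq_bigr do rewrite mulr1.
move=> ->; rewrite mulr1 /dyadic_sum; elim: L => [|L IH].
  by rewrite big_ord0 addr0 expr0.
by rewrite big_ord_recr /= mulr1 addrCA -[RHS]IH addrC exprS; congr (_ + _); field.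
Qed.

(** Independent signs and magnitudes. The index type ['I_N.+2] means [L = N + 1] dyadic values and
    the atom at 0, so that [N] truncation losses [2^-1 ^+ N.+1 / 2] from [dyadic_sum_tail] add up to
    at most 1/4. *)
Definition pareto_space (N : nat) : finType :=
  ({ffun 'I_N -> bool} * {ffun 'I_N -> 'I_N.+2})%type.

Definition pareto_space_prob (R : realType) (N : nat) (u : pareto_space N) : R :=
  rademacher_prob R u.1 * \prod_i pareto_prob R (u.2 i).

Definition pareto_var (R : realType) (r : R) (N : nat) (k : 'I_N)
    (u : pareto_space N) : R :=
  (-1) ^+ u.1 k * pareto_pow R (u.2 k) `^ r^-1.

Lemma pareto_space_sum (R : realType) (N : nat) (F : pareto_space N -> R) :
  \sum_u pareto_space_prob R u * F u =
  \sum_(j : {ffun 'I_N -> 'I_N.+2}) (\prod_i pareto_prob R (j i)) *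
    \sum_(s : {ffun 'I_N -> bool}) rademacher_prob R s * F (s, j).
Proof.
under [RHS]eq_bigr do rewrite mulr_sumr.
rewrite exchange_big pair_big /=; apply: eq_bigr => -[s j] _ /=.
by rewrite mulrCA mulrA.
Qed.

Lemma pareto_space_mass (R : realType) (N : nat) :
  \sum_(u : pareto_space N) pareto_space_prob R u = 1.
Proof.
have := pareto_space_sum (fun _ : pareto_space N => 1 : R).
under eq_bigr do rewrite mulr1; move=> ->.
rewrite -[RHS](product_mass N (pareto_prob_mass R N.+1)).
apply: eq_bigr => j _; rewrite (eq_bigr (@rademacher_prob R N)) => [|s _].
  by rewrite rademacher_prob_mass mulr1.
by rewrite mulr1.
Qed.

Lemma pareto_space_prob_ge0 (R : realType) (N : nat) (u : pareto_space N) :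
  0 <= pareto_space_prob R u.
Proof.
rewrite mulr_ge0 ?(ltW (rademacher_prob_gt0 _ _)) //.
by rewrite prodr_ge0 // => i _; exact: pareto_prob_ge0.
Qed.

Lemma pareto_var_sum (R : realType) (r : R) (N : nat) (a : 'I_N -> R) s j :
  \sum_k a k * pareto_var r k (s, j) =
  rademacher_sum (fun k => a k * pareto_pow R (j k) `^ r^-1) s.
Proof. by apply: eq_bigr => k _; rewrite /pareto_var /= mulrA mulrAC. Qed.

(** One large term is enough. With probability at least [1 - expR (- 4^-1)] some [|a k| ^ r] times
    its Pareto value is at least 1/2; by [rademacher_sum_large] the signs then make the whole sum at
    least as large as that term with probability at least 1/2. *)
Lemma pareto_anticoncentrated (R : realType) (r : R) (N : nat) : 0 < r ->
  anticoncentrated r 2^-1 ((1 - expR (- 4^-1)) / 2)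
    (@pareto_space_prob R N) (pareto_var r (N := N)).
Proof.
move=> r0; apply: normalized_anticoncentrated => // [|a a1].
  by rewrite pareto_space_mass; have := expR_gt0 (- 4^-1 : R); lra.
have a_le1 k : 0 <= `|a k| `^ r <= 1.
  by rewrite powR_ge0 /= -a1 (bigD1 k) //= lerDl sumr_ge0.
pose E k (o : 'I_N.+2) := 2^-1 <= `|a k| `^ r * pareto_pow R o.
rewrite pareto_space_sum.
have union := product_union E (@pareto_prob_ge0 R N.+1) (pareto_prob_mass R N.+1).
have tail : 4^-1 <= \sum_k \sum_t pareto_prob R t * (E k t)%:R.
  apply: (@le_trans _ _ (\sum_(k < N) (`|a k| `^ r / 2 - 2^-1 ^+ N.+1 / 2))).
    rewrite sumrB -mulr_suml a1 sumr_const card_ord -mulr_natl.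
    have : N%:R * 2^-1 ^+ N.+1 <= 2^-1 :> R.
      rewrite exprS mulrCA ler_piMr // exprVn ler_pdivrMr ?exprn_gt0 // mul1r.
      by rewrite -natrX ler_nat ltnW // ltn_expl.
    lra.
  apply: ler_sum => k _; rewrite (pareto_sum _ (fun x => (2^-1 <= x)%R%:R)).
  by apply: le_trans (dyadic_sum_tail _ (a_le1 k)) _; rewrite lerDr mulr_ge0 ?exprn_ge0.
apply: (@le_trans _ _ (\sum_(j : {ffun 'I_N -> 'I_N.+2}) (\prod_i pareto_prob R (j i)) *
    [exists k, E k (j k)]%:R / 2)).
  rewrite -mulr_suml ler_pM2r ?invr_gt0 //; apply: le_trans union.
  by rewrite lerD2l lerN2 ler_expR lerN2.
apply: ler_sum => j _; rewrite -mulrA ler_wpM2l ?prodr_ge0 // => [i _|].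
  exact: pareto_prob_ge0.
case: existsP => [[k Ek]|_]; last first.
  by rewrite mul0r sumr_ge0 // => s _; rewrite mulr_ge0 // ltW ?rademacher_prob_gt0.
rewrite mul1r; set c := fun k => a k * pareto_pow R (j k) `^ r^-1.
apply: le_trans (rademacher_sum_large c k) _; apply: ler_sum => s _.
rewrite ler_wpM2l ?(ltW (rademacher_prob_gt0 _ _)) // ler_nat.
apply: leq_b_imp => h; rewrite pareto_var_sum -/c.
apply: le_trans (_ : `|c k| `^ r <= _); last first.
  by rewrite ge0_ler_powR ?nnegrE ?(ltW r0).
rewrite normrM powRM // [`|_ `^ _|]ger0_norm ?powR_ge0 // -powRrM.
by rewrite mulVf ?gt_eqF // powRr1 ?pareto_pow_ge0.
Qed.

(** Given the magnitudes, [rademacher_moment] leaves the power [q / 2] of a sum of squares.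
    Averaging the squares first would fail, their means being unbounded in [N]; [powR_sum_le] takes
    the power of each large square instead. The exponents are then [q / r < 1 < 2 / r]. *)
Lemma pareto_moment (R : realType) (r q : R) : 0 < q -> q < r -> r < 2 ->
  exists2 K : R, 0 < K & forall N (a : 'I_N -> R),
    \sum_u pareto_space_prob R u * `|\sum_k a k * pareto_var r k u| `^ q <=
    K * (\sum_k `|a k| `^ r) `^ (q / r).
Proof.
move=> q0 qr r2; have r0 : 0 < r by lra.
have [K K0 hK] := rademacher_moment q0.
have [||C C0 hC] := @dyadic_sum_moment R (2 / r) (q / r).
- by rewrite divr_gt0 //= ltr_pdivrMr // mul1r.
- by rewrite ltr_pdivlMr // mul1r.
have KC0 : 0 < K * (1 + C) by rewrite mulr_gt0 // addr_gt0.
exists (K * (1 + C)) => // N; apply: normalized_moment => //; first exact: ltW.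
move=> a a1; rewrite pareto_space_sum.
have a_le1 k : 0 <= `|a k| `^ r <= 1.
  by rewrite powR_ge0 /= -a1 (bigD1 k) //= lerDl sumr_ge0.
pose psi x : R := Num.min (x `^ (2 / r)) (x `^ (q / r)).
apply: (@le_trans _ _ (\sum_(j : {ffun 'I_N -> 'I_N.+2}) (\prod_i pareto_prob R (j i)) *
    (K * (1 + \sum_k psi (`|a k| `^ r * pareto_pow R (j k)))))).
  apply: ler_sum => j _; rewrite ler_wpM2l ?prodr_ge0 // => [i _|].
    exact: pareto_prob_ge0.
  under eq_bigr do rewrite pareto_var_sum.
  apply: le_trans (hK _ _) _; rewrite ler_wpM2l ?(ltW K0) //.
  have q2 : 0 < q / 2 <= 1 by apply/andP; split; lra.
  apply: le_trans (powR_sum_le (y := fun k =>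
    (a k * pareto_pow R (j k) `^ r^-1) ^+ 2) q2 (fun k => sqr_ge0 _)) _.
  rewrite lerD2l; apply: ler_sum => k _; set x := _ * pareto_pow R (j k).
  suff -> : (a k * pareto_pow R (j k) `^ r^-1) ^+ 2 = x `^ (2 / r).
    rewrite -powRrM (_ : 2 / r * (q / 2) = q / r) //.
    by field; rewrite gt_eqF.
  have p0 := pareto_pow_ge0 R (j k).
  rewrite -real_normK ?num_real // normrM [`|_ `^ _|]ger0_norm ?powR_ge0 //.
  rewrite -powR_mulrn ?mulr_ge0 ?powR_ge0 // (mulrC 2 r^-1) powRrM.
  congr (_ `^ _); rewrite powRM ?powR_ge0 // -powRrM mulfV ?gt_eqF //.
  by rewrite powRr1.
have expand (j : {ffun 'I_N -> 'I_N.+2}) : (\prod_i pareto_prob R (j i)) *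
    (K * (1 + \sum_k psi (`|a k| `^ r * pareto_pow R (j k)))) =
    K * (\prod_i pareto_prob R (j i) + \sum_k (\prod_i pareto_prob R (j i)) *
      psi (`|a k| `^ r * pareto_pow R (j k))).
  by rewrite -mulr_sumr; ring.
under eq_bigr do rewrite expand.
rewrite -mulr_sumr ler_wpM2l ?(ltW K0) // big_split /=.
rewrite product_mass ?pareto_prob_mass // lerD2l exchange_big /=.
rewrite -[leRHS]mulr1 -[X in _ <= C * X]a1 mulr_sumr; apply: ler_sum => k _.
have /= -> := product_marginal k (fun o => psi (`|a k| `^ r * pareto_pow R o))
  (pareto_prob_mass R N.+1).
rewrite pareto_sum [psi 0]/psi !powR0 ?minxx ?mulr0 ?add0r ?hC //.
- by rewrite gt_eqF // divr_gt0.
- by rewrite gt_eqF // divr_gt0.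
Qed.

(** [Q] collects the exponents that one family of variables has to serve. None of [c], [d], [K]
    depends on [N], as the final limit requires. *)
Lemma randomization (R : realType) (r : R) (Q : R -> Prop) :
  (forall q, Q q -> 0 < q) -> 0 < r ->
  ((forall q, Q q -> q < r) /\ r < 2) \/ r = 2 ->
  exists c d : R, 0 < c /\ 0 < d /\
  exists (U : nat -> finType) (P : forall N, U N -> R)
         (th : forall N, 'I_N -> U N -> R),
  [/\ forall N, subprobability (P N),
      forall N, anticoncentrated r c d (P N) (th N) &
      forall q, Q q -> exists2 K : R, 0 < K & forall N (a : 'I_N -> R),
        \sum_u P N u * `|\sum_k a k * th N k u| `^ q <=
        K * (\sum_k `|a k| `^ r) `^ (q / r)].
Proof.
move=> Q0 r0 [[Qr r2]|->].
  exists 2^-1, ((1 - expR (- 4^-1)) / 2); split; first by rewrite invr_gt0.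
  split; first by rewrite divr_gt0 // subr_gt0 expR_lt1 oppr_lt0 invr_gt0.
  exists pareto_space, (@pareto_space_prob R), (@pareto_var R r); split.
  - by move=> N; split; [exact: pareto_space_prob_ge0|rewrite pareto_space_mass].
  - by move=> N; exact: pareto_anticoncentrated.
  - by move=> q Qq; apply: pareto_moment => //; [exact: Q0|exact: Qr].
have [d d0 hd] := rademacher_anticoncentration R.
have sq (x : R) : `|x| `^ 2 = x ^+ 2 by rewrite powR_mulrn // real_normK ?num_real.
exists 2^-1, d; split; first by rewrite invr_gt0.
split=> //.
exists (fun N => {ffun 'I_N -> bool}), (fun N => @rademacher_prob R N).
exists (fun N k (s : {ffun 'I_N -> bool}) => (-1) ^+ s k); split.
- move=> N; split; last by rewrite rademacher_prob_mass.
  by move=> u; exact: ltW (rademacher_prob_gt0 _ _).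
- move=> N a; apply: le_trans (hd N a) _; apply: ler_sum => s _.
  by rewrite sq (eq_bigr _ (fun k _ => sq (a k))).
- move=> q /Q0 q0; have [K K0 hK] := rademacher_moment q0.
  exists K => // N a; under [X in _ <= _ * X `^ _]eq_bigr do rewrite sq.
  exact: hK.
Qed.

(** * Expansion of multilinear operators *)

Definition fun_cons (Y : Type) (m : nat) (g : Y) (u : 'I_m -> Y) (i : 'I_m.+1) : Y :=
  oapp u g (unlift ord0 i).

Lemma fun_cons0 (Y : Type) (m : nat) (g : Y) (u : 'I_m -> Y) :
  fun_cons g u ord0 = g.
Proof. by rewrite /fun_cons unlift_none. Qed.

Lemma fun_consS (Y : Type) (m : nat) (g : Y) (u : 'I_m -> Y) i :
  fun_cons g u (lift ord0 i) = u i.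
Proof. by rewrite /fun_cons liftK. Qed.

Lemma fun_cons_eta (Y : Type) (m : nat) (f : 'I_m.+1 -> Y) :
  f = fun_cons (f ord0) (fun i => f (lift ord0 i)).
Proof.
by apply/funext => i; case: (unliftP ord0 i) => [j|] ->;
  rewrite ?fun_cons0 ?fun_consS.
Qed.

Lemma fun_cons_upd0 (Y : Type) (m : nat) (g h : Y) (u : 'I_m -> Y) :
  [eta fun_cons g u with ord0 |-> h] = fun_cons h u :> ('I_m.+1 -> Y).
Proof.
apply/funext => i /=; case: (unliftP ord0 i) => [j|] ->; last by rewrite eqxx fun_cons0.
by rewrite eq_sym (negPf (neq_lift _ _)) !fun_consS.
Qed.

Lemma fun_cons_updS (Y : Type) (m : nat) (g h : Y) (u : 'I_m -> Y) (i : 'I_m) :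
  [eta fun_cons g u with lift ord0 i |-> h] =
  fun_cons g [eta u with i |-> h] :> ('I_m.+1 -> Y).
Proof.
apply/funext => j /=; case: (unliftP ord0 j) => [l|] ->.
  by rewrite !fun_consS /= (inj_eq lift_inj).
by rewrite (negPf (neq_lift _ _)) !fun_cons0.
Qed.

(** Expand the first slot, then use the induction hypothesis with that slot frozen. Every use of
    linearity holds off a null set, and finitely many are used. *)
Lemma multilinear_sum (R : realType) (n m : nat)
    (D : 'I_m -> ('rV[R]_n -> R) -> Prop) (nu : {measure set 'rV[R]_n -> \bar R})
    (B : ('I_m -> 'rV[R]_n -> R) -> 'rV[R]_n -> R)
    (N : nat) (c : 'I_m -> 'I_N -> R) (f : 'I_m -> 'I_N -> 'rV[R]_n -> R) :
  (forall i, D i (fun=> 0)) ->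
  (forall i (a : R) g h, D i g -> D i h -> D i (fun x => a * g x + h x)) ->
  multilinear_on D (fun u v => u = v %[ae nu]) B ->
  (forall i k, D i (f i k)) ->
  B (fun i x => \sum_k f i k x * c i k) =
    (fun x => \sum_(k : {ffun 'I_m -> 'I_N})
       B (fun i => f i (k i)) x * \prod_i c i (k i)) %[ae nu].
Proof.
elim: m => [|m IH] in D B c f * => D0 Dlin mB Df.
  have e (k : {ffun 'I_0 -> 'I_N}) : (fun i => f i (k i)) =
      (fun i x => \sum_k f i k x * c i k) by apply/funext => -[].
  apply: aeW => x _; rewrite (sum_ffun0 _ (ffun0 (card_ord 0))) big_ord0 mulr1.
  by rewrite e.
have Dsum i (J : seq 'I_N) : D i (fun x => \sum_(k <- J) f i k x * c i k).
  elim: J => [|k J IHJ].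
    by rewrite (_ : (fun x => _) = fun=> 0) //; apply/funext => x; rewrite big_nil.
  rewrite (_ : (fun x => _) =
      fun x => c i k * f i k x + \sum_(k <- J) f i k x * c i k).
    exact: Dlin.
  by apply/funext => x; rewrite big_cons mulrC.
have Dcons g u : D ord0 g -> (forall j, D (lift ord0 j) (u j)) ->
    forall i, D i (fun_cons g u i).
  by move=> Dg Du i; case: (unliftP ord0 i) => [j|] ->; rewrite ?fun_cons0 ?fun_consS.
have lin0 u (J : seq 'I_N) : (forall j, D (lift ord0 j) (u j)) ->
    B (fun_cons (fun x => \sum_(k <- J) f ord0 k x * c ord0 k) u) =
    (fun x => \sum_(k <- J) B (fun_cons (f ord0 k) u) x * c ord0 k) %[ae nu].
  move=> Du; elim: J => [|k J IHJ].
    have -> : (fun x => \sum_(k <- [::]) f ord0 k x * c ord0 k) = fun=> 0.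
      by apply/funext => x; rewrite big_nil.
    (* With zero in the first slot and [a = 1], linearity says that the value equals twice itself
       almost everywhere. *)
    have := mB ord0 (fun_cons (fun=> 0) u) (fun=> 0) 1
      (Dcons _ _ (D0 ord0) Du) (D0 ord0).
    rewrite !fun_cons_upd0 fun_cons0 (_ : (fun x => _) = (fun=> 0)); last first.
      by apply/funext => x; rewrite mulr0 addr0.
    by apply: filterS => x h /h; rewrite big_nil; lra.
  have := mB ord0 (fun_cons (f ord0 k) u) _ (c ord0 k)
      (Dcons _ _ (Df ord0 k) Du) (Dsum ord0 J).
  rewrite !fun_cons_upd0 fun_cons0 (_ : (fun x => _ + _) =
      (fun x => \sum_(k <- k :: J) f ord0 k x * c ord0 k)); last first.
    by apply/funext => x; rewrite big_cons mulrC.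
  by move: IHJ; apply: filterS2 => x h1 h2 _; rewrite h2 // h1 // big_cons mulrC.
have IHl l : B (fun_cons (f ord0 l) (fun i x => \sum_k f (lift ord0 i) k x * c (lift ord0 i) k)) =
    (fun x => \sum_(k : {ffun 'I_m -> 'I_N})
       B (fun_cons (f ord0 l) (fun i => f (lift ord0 i) (k i))) x *
         \prod_i c (lift ord0 i) (k i)) %[ae nu].
  apply: (IH (fun i => D (lift ord0 i)) (fun u => B (fun_cons (f ord0 l) u))) => //.
    by move=> i a g h; exact: Dlin.
  move=> i u g a Du Dg.
  have := mB (lift ord0 i) (fun_cons (f ord0 l) u) g a (Dcons _ _ (Df ord0 l) Du) Dg.
  by rewrite fun_consS !fun_cons_updS.
have lin1 := lin0 (fun i x => \sum_k f (lift ord0 i) k x * c (lift ord0 i) k)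
  (index_enum 'I_N) (fun j => Dsum (lift ord0 j) _).
have IHall : \forall x \ae nu, forall l, setT x ->
    B (fun_cons (f ord0 l) (fun i x => \sum_k f (lift ord0 i) k x * c (lift ord0 i) k)) x =
    \sum_(k : {ffun 'I_m -> 'I_N})
       B (fun_cons (f ord0 l) (fun i => f (lift ord0 i) (k i))) x *
         \prod_i c (lift ord0 i) (k i).
  by apply: filter_forall => l; exact: IHl.
rewrite (fun_cons_eta (fun i x => \sum_k f i k x * c i k)).
move: lin1 IHall; apply: filterS2 => x h1 h2 _.
rewrite h1 // sum_ffun_recl; apply: eq_bigr => l _.
rewrite h2 // mulr_suml; apply: eq_bigr => k _.
rewrite (fun_cons_eta (fun i => f i (ffun_cons l k i))) ffun_cons0.
have -> : (fun i : 'I_m => f (lift ord0 i) (ffun_cons l k (lift ord0 i))) =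
    fun i => f (lift ord0 i) (k i) by apply/funext => i; rewrite ffun_consS.
rewrite (prod_ffun_recl c) -mulrA; congr (_ * _); exact: mulrC.
Qed.

(** * Operator norms *)

Lemma Lfun_lin d (T : measurableType d) (R : realType)
    (mu : {measure set T -> \bar R}) (q : R) : 1 <= q ->
  forall (a : R) (g h : T -> R), g \in Lfun mu q%:E -> h \in Lfun mu q%:E ->
  (fun x => a * g x + h x) \in Lfun mu q%:E.
Proof.
rewrite -lee_fin => q1 a g h gL hL.
have [_] := @Lfun_submod_closed _ _ _ mu _ q1; exact.
Qed.

Lemma Lfun0 d (T : measurableType d) (R : realType)
    (mu : {measure set T -> \bar R}) (q : R) : 1 <= q ->
  (fun=> 0) \in Lfun mu q%:E.
Proof.
by rewrite -lee_fin => q1; have [] := @Lfun_submod_closed _ _ _ mu _ q1.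
Qed.

Lemma Lfun_sum d (T : measurableType d) (R : realType)
    (mu : {measure set T -> \bar R}) (q : R) (N : nat) (c : 'I_N -> R)
    (f : 'I_N -> T -> R) : 1 <= q -> (forall k, f k \in Lfun mu q%:E) ->
  (fun x => \sum_k f k x * c k) \in Lfun mu q%:E.
Proof.
move=> q1 fL; elim: (index_enum _) => [|k J IH].
  rewrite (_ : (fun x => _) = fun=> 0) ?Lfun0 //.
  by apply/funext => x; rewrite big_nil.
rewrite (_ : (fun x => _) = fun x => c k * f k x + \sum_(k <- J) f k x * c k).
  exact: Lfun_lin.
by apply/funext => x; rewrite big_cons mulrC.
Qed.

Lemma Lfun_measurable d (T : measurableType d) (R : realType)
    (mu : {measure set T -> \bar R}) (q : \bar R) (f : T -> R) :
  f \in Lfun mu q -> measurable_fun setT f.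
Proof. by move=> /sub_Lfun_mfun; rewrite inE. Qed.

Lemma Lfun_Lnorm d (T : measurableType d) (R : realType)
    (mu : {measure set T -> \bar R}) (q : \bar R) (f : T -> R) :
  f \in Lfun mu q -> (Lnorm mu q (EFin \o f) < +oo)%E.
Proof. by move=> /sub_Lfun_finLfun; rewrite inE. Qed.

Lemma LnormZl d (T : measurableType d) (R : realType)
    (mu : {measure set T -> \bar R}) (q a : R) (f : T -> R) : 0 < q ->
  measurable_fun setT f ->
  Lnorm mu q%:E (EFin \o (fun x => f x * a)) =
  (`|a|%:E * Lnorm mu q%:E (EFin \o f))%E.
Proof.
move=> q0 mf; rewrite unlock.
under eq_integral do rewrite /= normrM mulrC powRM // EFinM.
rewrite ge0_integralZl_EFin ?powR_ge0 //.
- rewrite poweRM ?lee_fin ?powR_ge0 ?integral_ge0 //.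
  by rewrite poweR_EFin -powRrM mulfV ?gt_eqF // powRr1.
- apply/measurable_EFinP; apply: (measurableT_comp (measurable_powR q)).
  exact: measurableT_comp.
Qed.

(* Properties of the target quasi-norm shared by [L^p] and weak [L^p]. *)
Definition homogeneous_norm d (T : measurableType d) (R : realType)
    (nu : {measure set T -> \bar R}) (N : (T -> \bar R) -> \bar R) : Prop :=
  [/\ forall h, (0 <= N h)%E,
      forall u v : T -> R, measurable_fun setT u -> measurable_fun setT v ->
        u = v %[ae nu] -> (N (EFin \o u) <= N (EFin \o v))%E &
      forall (a : R) (u : T -> R), 0 < a -> measurable_fun setT u ->
        (N (EFin \o (fun x => (u x * a)%R)) <= a%:E * N (EFin \o u))%E].

Lemma operator_norm_ge0 (R : realType) (n m : nat)
    (mu : 'I_m -> {measure set 'rV[R]_n -> \bar R}) (q : 'I_m -> R)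
    (nu : {measure set 'rV[R]_n -> \bar R}) (N : ('rV[R]_n -> \bar R) -> \bar R)
    (B : ('I_m -> 'rV[R]_n -> R) -> 'rV[R]_n -> R) :
  (forall i, 1 <= q i) -> homogeneous_norm nu N ->
  (0 <= operator_norm mu q N B)%E.
Proof.
move=> q1 [N0 _ _].
apply: le_ereal_sup_tmp; exists (N (EFin \o B (fun i x => 0))) => //.
exists (fun i x => 0) => //= i; split; first exact: Lfun0.
have -> : (EFin \o (fun=> 0)) = cst 0%E :> ('rV[R]_n -> \bar R) by [].
by rewrite Lnorm0 // eqe gt_eqF // (lt_le_trans ltr01).
Qed.

Lemma operator_norm_lty (R : realType) (n m : nat)
    (mu : 'I_m -> {measure set 'rV[R]_n -> \bar R}) (q : 'I_m -> R)
    (nu : {measure set 'rV[R]_n -> \bar R}) (N : ('rV[R]_n -> \bar R) -> \bar R)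
    (B : ('I_m -> 'rV[R]_n -> R) -> 'rV[R]_n -> R) :
  bounded_multilinear mu q nu N B -> (operator_norm mu q N B < +oo)%E.
Proof.
move=> [_ _ [C BC]]; apply: (@le_lt_trans _ _ `|C|%:E); last by rewrite ltry.
apply: ge_ereal_sup => _ [f /= fL <-].
apply: le_trans (BC f (fun i => (fL i).1)) _.
rewrite -[leRHS]mule1; apply: (@le_trans _ _ (`|C|%:E *
    \big[*%E/1]_(i < m) Lnorm (mu i) (q i)%:E (EFin \o f i))%E).
  rewrite lee_wpmul2r ?lee_fin ?ler_norm // prode_ge0 // => i _.
  exact: Lnorm_ge0.
rewrite lee_wpmul2l ?lee_fin //.
suff /andP[] : (0 <= \big[*%E/1]_(i < m) Lnorm (mu i) (q i)%:E (EFin \o f i) <= 1)%E.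
  by [].
elim/big_ind : _ => [|x y /andP[x0 x1] /andP[y0 y1]|i _].
- by rewrite lee01 lexx.
- by rewrite mule_ge0 //= -[leRHS]mule1 lee_pmul.
- by rewrite Lnorm_ge0; have [] := fL i.
Qed.

(** Divide each [f i] by its norm [t i] and recover [B f] from the normalized tuple by
    [multilinear_sum] with one term per slot. *)
Lemma operator_norm_bound (R : realType) (n m : nat)
    (mu : 'I_m -> {measure set 'rV[R]_n -> \bar R}) (q : 'I_m -> R)
    (nu : {measure set 'rV[R]_n -> \bar R}) (N : ('rV[R]_n -> \bar R) -> \bar R)
    (B : ('I_m -> 'rV[R]_n -> R) -> 'rV[R]_n -> R) (f : 'I_m -> 'rV[R]_n -> R) :
  (forall i, 1 <= q i) -> homogeneous_norm nu N ->
  bounded_multilinear mu q nu N B -> (forall i, f i \in Lfun (mu i) (q i)%:E) ->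
  (N (EFin \o B f) <= operator_norm mu q N B *
     \big[*%E/1]_(i < m) Lnorm (mu i) (q i)%:E (EFin \o f i))%E.
Proof.
move=> q1 [N0 Nae Nscale] bB fL; have [mB linB [C BC]] := bB.
have q0 i : 0 < q i by rewrite (lt_le_trans ltr01).
pose t i := fine (Lnorm (mu i) (q i)%:E (EFin \o f i)).
have tE i : Lnorm (mu i) (q i)%:E (EFin \o f i) = (t i)%:E.
  by rewrite fineK // ge0_fin_numE ?Lnorm_ge0 // (Lfun_Lnorm (fL i)).
have t0 i : 0 <= t i by rewrite -lee_fin -tE Lnorm_ge0.
under eq_bigr do rewrite tE.
rewrite prodEFin.
have [/existsP[j /eqP tj]|] := boolP [exists j, t j == 0].
  (* A function of norm 0 cannot be normalized; boundedness with the finite constant [C] makes the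
     left side vanish. *)
  rewrite [X in (_ * X%:E)%E](bigD1 j) //= tj mul0r mule0.
  apply: le_trans (BC f fL) _; under eq_bigr do rewrite tE.
  by rewrite prodEFin (bigD1 j) //= tj mul0r mule0.
rewrite negb_exists => /forallP tn0.
have tp i : 0 < t i by rewrite lt_neqAle eq_sym tn0 t0.
pose g i x := f i x * (t i)^-1.
have gL i : g i \in Lfun (mu i) (q i)%:E.
  have := Lfun_lin (q1 i) (t i)^-1 (fL i) (Lfun0 (mu i) (q1 i)).
  by rewrite (_ : (fun x => _) = g i) //; apply/funext => x; rewrite addr0 mulrC.
have g1 i : (Lnorm (mu i) (q i)%:E (EFin \o g i) <= 1)%E.
  rewrite (LnormZl _ _ (q0 i) (Lfun_measurable (fL i))) tE -EFinM.
  by rewrite gtr0_norm ?invr_gt0 // mulVf // gt_eqF.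
have := @multilinear_sum R n m (fun i h => h \in Lfun (mu i) (q i)%:E) nu B 1
  (fun i _ => t i) (fun i _ => g i) (fun i => Lfun0 (mu i) (q1 i))
  (fun i => Lfun_lin (q1 i)) linB (fun i _ => gL i).
have -> : (fun i x => \sum_(k < 1) g i x * t i) = f.
  by apply/funext => i; apply/funext => x; rewrite big_ord1 /g divfK // gt_eqF.
move=> Bg; have Bfg : B f = (fun x => B g x * \prod_i t i) %[ae nu].
  by apply: filterS Bg => x h /h ->; rewrite sumr_const card_ffun card_ord exp1n.
apply: le_trans (Nae _ _ (mB f fL) _ Bfg) _.
  by apply: measurable_funM => //; exact: mB.
have tP : 0 < \prod_i t i by apply: prodr_gt0.
apply: le_trans (Nscale _ _ tP (mB g gL)) _.
rewrite muleC lee_wpmul2r ?lee_fin ?(ltW tP) //.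
by apply: ereal_sup_ubound; exists g.
Qed.

Lemma homogeneous_Lnorm d (T : measurableType d) (R : realType)
    (nu : {measure set T -> \bar R}) (p : R) : 0 < p ->
  homogeneous_norm nu (Lnorm nu p%:E).
Proof.
move=> p0; split=> [h|u v mu mv uv|a u a0 mu]; first exact: Lnorm_ge0.
  rewrite unlock le_eqVlt; apply/orP; left; apply/eqP; congr (_ `^ _)%E.
  have mp (w : T -> R) : measurable_fun setT w ->
      measurable_fun setT (fun x => (`|(EFin \o w) x| `^ p)%E).
    move=> mw; apply/measurable_EFinP; apply: (measurableT_comp (measurable_powR p)).
    exact: measurableT_comp.
  apply: ge0_ae_eq_integral => //.
  - exact: mp.
  - exact: mp.
  - by move=> x _; exact: poweR_ge0.
  - by move=> x _; exact: poweR_ge0.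
  - by apply: filterS uv => x /= h xT; rewrite h.
by rewrite LnormZl // gtr0_norm.
Qed.

Lemma homogeneous_weak_Lnorm (R : realType) (n : nat)
    (nu : {measure set 'rV[R]_n -> \bar R}) (p : R) : 0 < p ->
  homogeneous_norm nu (weak_Lnorm nu p).
Proof.
move=> p0.
have mlevel (w : 'rV[R]_n -> R) (l : R) : measurable_fun setT w ->
    measurable [set x | (l%:E < `|(EFin \o w) x|)%E].
  move=> mw; rewrite -[X in measurable X]setTI.
  apply: (emeasurable_fun_o_infty measurableT); apply: measurableT_comp => //.
  exact/measurable_EFinP.
split=> [h|u v mu mv uv|a u a0 mu].
- apply: le_ereal_sup_tmp; exists (1%:E * nu [set x | 1%:E < `|h x|] `^ p^-1)%E.
    by exists 1 => //=; exact: ltr01.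
  by rewrite mul1e poweR_ge0.
- apply: ge_ereal_sup => _ [l /= l0 <-].
  apply: ereal_sup_ubound; exists l => //=; congr (_ * _ `^ _)%E.
  have muE (w : 'rV[R]_n -> R) : measurable_fun setT w -> nu [set x | (l%:E < `|(EFin \o w) x|)%E] =
      (\int[nu]_x (\1_[set x | (l%:E < `|(EFin \o w) x|)%E] x)%:E)%E.
    by move=> mw; rewrite integral_indic ?setIT //; exact: mlevel.
  rewrite !muE //; apply: ge0_ae_eq_integral => //.
  - by apply/measurable_EFinP; apply: measurable_indic; exact: mlevel.
  - by apply/measurable_EFinP; apply: measurable_indic; exact: mlevel.
  - apply: filterS uv => x /= h xT; rewrite !indicE.
    by congr ((nat_of_bool _)%:R%:E); apply/idP/idP; rewrite !inE /= h.
- apply: ge_ereal_sup => _ [l /= l0 <-].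
  have -> : [set x | (l%:E < `|(u x * a)%:E|)%E] =
     [set x | ((l / a)%:E < `|(EFin \o u) x|)%E].
    apply/funext => x /=; rewrite !lte_fin normrM (gtr0_norm a0).
    by rewrite ltr_pdivrMr.
  set V := (nu _ `^ _)%E.
  rewrite [leLHS](_ : _ = (a%:E * ((l / a)%:E * V))%E); last first.
    by rewrite muleA -EFinM mulrC divfK ?gt_eqF.
  rewrite lee_wpmul2l ?lee_fin ?(ltW a0) //.
  by apply: ereal_sup_ubound; exists (l / a) => //=; exact: divr_gt0.
Qed.

(** A crude Jensen inequality for a concave power. If [M] is a positive real [r], then
    [y u ^ s <= r ^ s * (1 + y u / r)], and both summands average to at most 1, whence the factor
    2. *)
Lemma sum_poweR_le (R : realType) (U : finType) (P y : U -> R) (M : \bar R) (s : R) :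
  subprobability P -> 0 < s <= 1 -> (forall u, 0 <= y u) ->
  ((\sum_u P u * y u)%:E <= M)%E ->
  ((\sum_u P u * y u `^ s)%:E <= 2%:E * M `^ s)%E.
Proof.
move=> [P0 P1] /andP[s0 s1] y0.
have Py0 u : 0 <= P u * y u by rewrite mulr_ge0.
case: M => [r|_|]; last by rewrite leeNy_eq.
  rewrite poweR_EFin -EFinM !lee_fin => Pyr.
  have r0 : 0 <= r by apply: le_trans Pyr; apply: sumr_ge0.
  have [r00|rn0] := eqVneq r 0.
    have S0 : \sum_u P u * y u = 0.
      by apply/eqP; rewrite eq_le sumr_ge0 // andbT (le_trans Pyr) ?r00.
    rewrite big1 ?mulr_ge0 ?powR_ge0 // => u _.
    have /(_ u isT)/eqP := psumr_eq0P (fun u _ => Py0 u) S0.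
    rewrite mulf_eq0 => /orP[/eqP ->|/eqP ->]; first by rewrite mul0r.
    by rewrite powR0 ?mulr0 ?gt_eqF.
  have rp : 0 < r by rewrite lt_neqAle eq_sym rn0.
  have step u : y u `^ s <= r `^ s * (1 + y u / r).
    rewrite -{1}[y u](divfK rn0) powRM ?divr_ge0 // mulrC ler_wpM2l ?powR_ge0 //.
    have yr0 : 0 <= y u / r by rewrite divr_ge0.
    have [yr1|/ltW yr1] := leP (y u / r) 1.
      apply: (@le_trans _ _ 1); last by rewrite lerDl.
      rewrite [leRHS](_ : _ = 1 `^ s); last by rewrite powR1.
      by rewrite ge0_ler_powR ?nnegrE ?(ltW s0).
    by apply: (le_trans (ler1_powR yr1 s1)); rewrite lerDr.
  apply: (@le_trans _ _ (\sum_u r `^ s * (P u + P u * y u / r))).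
    apply: ler_sum => u _; apply: le_trans (ler_wpM2l (P0 u) (step u)) _.
    by rewrite mulrCA mulrDr mulr1 mulrA.
  rewrite -mulr_sumr mulrC ler_wpM2r ?powR_ge0 // big_split /= -mulr_suml.
  have : (\sum_u P u * y u) / r <= 1 by rewrite ler_pdivrMr // mul1r.
  by lra.
by rewrite poweRyr ?gt_eqF // gt0_muley ?leey // lte_fin.
Qed.

(** * Randomized inequalities for finite families *)

Lemma lee_prod (R : realType) (I : finType) (a b : I -> \bar R) :
  (forall i, 0 <= a i <= b i)%E -> (\big[*%E/1]_i a i <= \big[*%E/1]_i b i)%E.
Proof.
move=> ab; suff /andP[] : (0 <= \big[*%E/1]_i a i <= \big[*%E/1]_i b i)%E by [].
elim/big_ind2 : _ => [|a1 a2 b1 b2 /andP[? ?] /andP[? ?]|i _].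
- by rewrite lee01 lexx.
- by rewrite mule_ge0 // lee_pmul.
- exact: ab.
Qed.

Lemma measurable_powR_norm d (T : measurableType d) (R : realType) (r : R)
    (g : T -> R) : measurable_fun setT g ->
  measurable_fun setT (fun x => `|g x| `^ r).
Proof.
move=> mg; apply: (measurableT_comp (measurable_powR r)).
exact: measurableT_comp.
Qed.

Lemma measurable_lr_sum d (T : measurableType d) (R : realType) (r s : R)
    (J : finType) (g : J -> T -> R) : (forall j, measurable_fun setT (g j)) ->
  measurable_fun setT (fun x => (\sum_j `|g j x| `^ r) `^ s).
Proof.
move=> mg; apply: (measurableT_comp (measurable_powR s)).
by apply: measurable_sum => j; exact: measurable_powR_norm.
Qed.

Lemma powR_Lnorm_Lfun d (T : measurableType d) (R : realType)
    (mu : {measure set T -> \bar R}) (q p : R) (g : T -> R) :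
  (Lnorm mu q%:E (EFin \o g) `^ p =
   (\int[mu]_x (`|g x| `^ q)%:E) `^ (p / q))%E.
Proof. by rewrite unlock -poweRrM mulrC. Qed.

(** As [p <= q], [sum_poweR_le] moves the power [p / q] outside the average. What remains is a
    [q]-th moment, where average and integral commute and the moment bound applies at each [x] to
    the coefficients [f k x]. *)
Lemma random_moment_bound d (T : measurableType d) (R : realType)
    (mu : {measure set T -> \bar R}) (N : nat) (U : finType) (P : U -> R)
    (th : 'I_N -> U -> R) (p q r K : R) (f : 'I_N -> T -> R) :
  subprobability P -> 0 < p <= q -> 1 <= q -> 0 < K ->
  (forall a : 'I_N -> R, \sum_u P u * `|\sum_k a k * th k u| `^ q <=
     K * (\sum_k `|a k| `^ r) `^ (q / r)) ->
  (forall k, f k \in Lfun mu q%:E) ->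
  (\sum_u (P u)%:E * Lnorm mu q%:E (EFin \o (fun x => \sum_k f k x * th k u)%R) `^ p
   <= (2 * K `^ (p / q))%:E *
      (\int[mu]_x ((\sum_k `|f k x| `^ r) `^ (q / r))%:E) `^ (p / q))%E.
Proof.
move=> PP /andP[p0 pq] q1 K0 KU fL; have q0 : 0 < q by lra.
have [P0 _] := PP.
have mf k : measurable_fun setT (f k) by exact: Lfun_measurable (fL k).
pose g u x := \sum_k f k x * th k u.
have gL u : g u \in Lfun mu q%:E by exact: Lfun_sum.
have mg u : measurable_fun setT (g u) by exact: Lfun_measurable (gL u).
have I0 u : (0 <= \int[mu]_x (`|g u x| `^ q)%:E)%E.
  by apply: integral_ge0 => x _; rewrite lee_fin powR_ge0.
pose y u := fine (\int[mu]_x (`|g u x| `^ q)%:E)%E.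
have yE u : (\int[mu]_x (`|g u x| `^ q)%:E)%E = (y u)%:E.
  rewrite fineK // ge0_fin_numE //.
  have := Lfun_Lnorm (gL u); rewrite unlock => /lty_poweRy; apply.
  by rewrite invr_eq0 gt_eqF.
under eq_bigr do rewrite powR_Lnorm_Lfun yE poweR_EFin -EFinM.
rewrite sumEFin EFinM -muleA -poweR_EFin -poweRM ?lee_fin ?(ltW K0) //; last first.
  by apply: integral_ge0 => x _; rewrite lee_fin powR_ge0.
apply: sum_poweR_le => //.
- by rewrite divr_gt0 //= ler_pdivrMr // mul1r.
- by move=> u; rewrite -lee_fin -yE.
have mgq u : measurable_fun setT (fun x => `|g u x| `^ q).
  exact: measurable_powR_norm.
have PyE u : (P u * y u)%:E = (\int[mu]_x (P u * `|g u x| `^ q)%:E)%E.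
  rewrite EFinM -yE -ge0_integralZl_EFin //.
  exact/measurable_EFinP.
rewrite -sumEFin (eq_bigr _ (fun u _ => PyE u)) -ge0_integral_sum //.
- rewrite -ge0_integralZl_EFin ?(ltW K0) //.
  + apply: ge0_le_integral => //.
    * by move=> x _; rewrite sumEFin lee_fin sumr_ge0 // => u _; rewrite mulr_ge0 ?powR_ge0.
    * under eq_fun do rewrite sumEFin.
      apply/measurable_EFinP/measurable_sum => u.
      exact: measurable_funM.
    * apply/measurable_EFinP; apply: measurable_funM => //.
      exact: measurable_lr_sum.
    * by move=> x _; rewrite sumEFin lee_fin; exact: KU.
  + by move=> x _; rewrite lee_fin powR_ge0.
  + by apply/measurable_EFinP; exact: measurable_lr_sum.
- by move=> u; apply/measurable_EFinP; exact: measurable_funM.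
- by move=> u x _; rewrite lee_fin mulr_ge0 ?powR_ge0.
Qed.

Lemma finite_marcinkiewicz_zygmund (R : realType) (n m N : nat)
    (mu : 'I_m -> {measure set 'rV[R]_n -> \bar R}) (q : 'I_m -> R)
    (nu : {measure set 'rV[R]_n -> \bar R})
    (B : ('I_m -> 'rV[R]_n -> R) -> 'rV[R]_n -> R) (p r c d H : R) (K : 'I_m -> R)
    (U : finType) (P : U -> R) (th : 'I_N -> U -> R) (phi : R -> R)
    (f : 'I_m -> 'I_N -> 'rV[R]_n -> R) :
  (forall i, 1 <= q i) -> 0 < p -> (forall i, p <= q i) -> 0 < r -> 0 < c ->
  0 < d -> 0 <= H -> (forall i, 0 < K i) ->
  subprobability P -> anticoncentrated r c d P th ->
  (forall i (a : 'I_N -> R), \sum_u P u * `|\sum_k a k * th k u| `^ q i <=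
     K i * (\sum_k `|a k| `^ r) `^ (q i / r)) ->
  (forall t, 0 <= phi t) -> {in Num.nneg &, {homo phi : x y / x <= y}} ->
  measurable_fun setT phi ->
  (forall g, (forall i, g i \in Lfun (mu i) (q i)%:E) -> measurable_fun setT (B g)) ->
  multilinear_on (fun i g => g \in Lfun (mu i) (q i)%:E)
    (fun u v => u = v %[ae nu]) B ->
  (forall g, (forall i, g i \in Lfun (mu i) (q i)%:E) ->
    (\int[nu]_x (phi (`|B g x| / ((c * (d / 2)) ^+ m) `^ r^-1))%:E <=
     H%:E * \big[*%E/1]_(i < m) Lnorm (mu i) (q i)%:E (EFin \o g i) `^ p)%E) ->
  (forall i k, f i k \in Lfun (mu i) (q i)%:E) ->
  (\int[nu]_x (phi ((\sum_(k : {ffun 'I_m -> 'I_N})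
      `|B (fun i => f i (k i)) x| `^ r) `^ r^-1))%:E <=
   (H / (d / 2) ^+ m * \prod_i (2 * K i `^ (p / q i)))%:E *
   \big[*%E/1]_(i < m)
     (\int[mu i]_x ((\sum_k `|f i k x| `^ r) `^ (q i / r))%:E) `^ (p / q i))%E.
Proof.
move=> q1 p0 pq r0 c0 d0 H0 K0 PP ac KU phi0 phi_homo mphi mB linB phiB fL.
have [P0 P1] := PP.
set C := (c * (d / 2)) ^+ m in phiB; set D := (d / 2) ^+ m.
have C0 : 0 < C by rewrite exprn_gt0 // mulr_gt0 // divr_gt0.
have D0 : 0 < D by rewrite exprn_gt0 // divr_gt0.
have Cr0 : 0 < C `^ r^-1 by rewrite powR_gt0.
pose b (k : {ffun 'I_m -> 'I_N}) x := B (fun i => f i (k i)) x.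
pose F x := (\sum_k `|b k x| `^ r) `^ r^-1.
pose S (u : {ffun 'I_m -> U}) x := \sum_k b k x * \prod_i th (k i) (u i).
pose w (u : {ffun 'I_m -> U}) := \prod_i P (u i).
pose g (u : {ffun 'I_m -> U}) i x := \sum_k f i k x * th k (u i).
have w0 u : 0 <= w u by apply: prodr_ge0.
have mb k : measurable_fun setT (b k) by apply: mB => i; exact: fL.
have mF : measurable_fun setT F by exact: measurable_lr_sum.
have mS u : measurable_fun setT (S u).
  by apply: measurable_sum => k; apply: measurable_funM.
have gL u i : g u i \in Lfun (mu i) (q i)%:E by exact: Lfun_sum.
have mphiE (h : 'rV[R]_n -> R) : measurable_fun setT h ->
    measurable_fun setT (fun x => (phi (`|h x| / C `^ r^-1))%:E).
  move=> mh; apply/measurable_EFinP/(measurableT_comp mphi).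
  by apply: measurable_funM => //; exact: measurableT_comp.
have BS u : B (g u) = S u %[ae nu].
  apply: (@multilinear_sum R n m (fun i h => h \in Lfun (mu i) (q i)%:E) nu B N
    (fun i k => th k (u i)) f) => // i.
  - exact: Lfun0.
  - by move=> a h1 h2; exact: Lfun_lin.
(* On the event of [anticoncentration_chaos], of probability at least [D], [F x] is at most
   [|S u x|] divided by the [r]-th root of [C]; elsewhere [phi >= 0] suffices. *)
have pointwise x : D * phi (F x) <= \sum_u w u * phi (`|S u x| / C `^ r^-1).
  apply: le_trans (ler_wpM2r (phi0 _)
    (anticoncentration_chaos (fun k => b k x) PP c0 d0 ac)) _.
  rewrite mulr_suml; apply: ler_sum => u _; rewrite -mulrA ler_wpM2l ?w0 // -/C -/(S u x).
  case: (leP (C * \sum_k `|b k x| `^ r) (`|S u x| `^ r)) => [CS|_]; last by rewrite mul0r.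
  rewrite mul1r; apply: phi_homo; rewrite ?nnegrE ?divr_ge0 ?powR_ge0 //.
  rewrite ler_pdivlMr // /F -powRM ?(ltW C0) ?sumr_ge0 //.
  rewrite -[leRHS]powRr1 // -(mulfV (lt0r_neq0 r0)) powRrM mulrC.
  by rewrite ge0_ler_powR ?nnegrE ?invr_ge0 ?powR_ge0 ?mulr_ge0 ?sumr_ge0 ?(ltW C0) ?(ltW r0).
have intS u : (\int[nu]_x (phi (`|S u x| / C `^ r^-1))%:E <=
    H%:E * \big[*%E/1]_(i < m) Lnorm (mu i) (q i)%:E (EFin \o g u i) `^ p)%E.
  apply: le_trans (phiB _ (gL u)); rewrite le_eqVlt; apply/orP; left; apply/eqP.
  apply: ge0_ae_eq_integral => //; [exact: mphiE|by apply: mphiE; exact: mB| | |].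
  - by move=> x _; rewrite lee_fin.
  - by move=> x _; rewrite lee_fin.
  - by apply: filterS (BS u) => x h xT; rewrite h.
have -> : H / D * \prod_i (2 * K i `^ (p / q i)) =
    D^-1 * (H * \prod_i (2 * K i `^ (p / q i))) by rewrite mulrCA mulrA.
rewrite EFinM -muleA lee_pdivlMl // -ge0_integralZl_EFin ?(ltW D0) //; last first.
- by apply/measurable_EFinP; exact: (measurableT_comp mphi).
- by move=> x _; rewrite lee_fin.
apply: (@le_trans _ _ (\int[nu]_x \sum_u ((w u)%:E * (phi (`|S u x| / C `^ r^-1))%:E))%E).
  apply: ge0_le_integral => //.
  - by move=> x _; rewrite lee_fin mulr_ge0 // ltW.
  - apply/measurable_EFinP; apply: measurable_funM => //.
    exact: (measurableT_comp mphi).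
  - apply: emeasurable_sum => u.
    by apply: emeasurable_funM => //; exact: mphiE.
  - move=> x _; under [leRHS]eq_bigr do rewrite -EFinM.
    by rewrite sumEFin -EFinM lee_fin; exact: pointwise.
rewrite ge0_integral_sum //; last first.
- by move=> u x _; rewrite mule_ge0 ?lee_fin.
- by move=> u; apply: emeasurable_funM => //; exact: mphiE.
apply: (@le_trans _ _ (\sum_u ((w u)%:E * (H%:E *
    \big[*%E/1]_(i < m) Lnorm (mu i) (q i)%:E (EFin \o g u i) `^ p)))%E).
  apply: lee_sum => u _; rewrite ge0_integralZl_EFin //.
  - by rewrite lee_wpmul2l ?lee_fin.
  - by move=> x _; rewrite lee_fin.
  - exact: mphiE.
pose t i (v : U) : R := fine (Lnorm (mu i) (q i)%:E
  (EFin \o (fun x => (\sum_k f i k x * th k v)%R)) `^ p)%E.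
have t0 i v : 0 <= t i v by rewrite fine_ge0 ?poweR_ge0.
have tE i v : (Lnorm (mu i) (q i)%:E
    (EFin \o (fun x => (\sum_k f i k x * th k v)%R)) `^ p)%E = (t i v)%:E.
  rewrite fineK // ge0_fin_numE ?poweR_ge0 // poweR_lty //.
  exact: Lfun_Lnorm (Lfun_sum (th ^~ v) (q1 i) (fL i)).
(* Independence: weights and norms both factor over the slots, so the average of the product is the
   product of the averages. *)
have -> : (\sum_u ((w u)%:E * (H%:E *
    \big[*%E/1]_(i < m) Lnorm (mu i) (q i)%:E (EFin \o g u i) `^ p)))%E =
    (H * \prod_i \sum_v P v * t i v)%:E.
  rewrite bigA_distr_bigA mulr_sumr -sumEFin; apply: eq_bigr => u _.
  rewrite (eq_bigr (fun i => (t i (u i))%:E)) => [|i _]; last exact: tE.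
  by rewrite prodEFin -!EFinM big_split /= mulrCA.
rewrite !EFinM -muleA lee_wpmul2l ?lee_fin //.
rewrite -!prodEFin -big_split /=; apply: lee_prod => i.
apply/andP; split.
  by rewrite lee_fin sumr_ge0 // => v _; rewrite mulr_ge0.
rewrite -sumEFin; under eq_bigr do rewrite EFinM -tE.
by apply: random_moment_bound => //; rewrite p0 pq.
Qed.

(** * Passage to infinite families *)

(** Boxes increase and exhaust all multi-indices, which turns the unordered sum into a monotone
    limit of finite sums. *)
Definition index_box (m N : nat) : set {ffun 'I_m -> nat} :=
  [set k | forall i, (k i < N)%N].
Arguments index_box : clear implicits.

Lemma esum_index_box (R : realType) (m N : nat) (a : {ffun 'I_m -> nat} -> \bar R) :
  (forall k, 0 <= a k)%E ->
  (\esum_(k in index_box m N) a k =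
   \sum_(k : {ffun 'I_m -> 'I_N}) a [ffun i => k i : nat])%E.
Proof.
move=> a0.
rewrite (reindex_esum [set: {ffun 'I_m -> 'I_N}] _
  (fun k : {ffun 'I_m -> 'I_N} => [ffun i => k i : nat])).
  rewrite esum_fset //; last exact: finite_finset.
  rewrite (fsbigE (enum {ffun 'I_m -> 'I_N})) ?enum_uniq //.
    by rewrite big_enum_cond /=; apply: eq_bigl => k; exact: mem_set.
  by move=> k _ /=; rewrite mem_enum.
split=> [k _ i /=|k l _ _ /ffunP kl|k kN].
- by rewrite ffunE.
- by apply/ffunP => i; apply: val_inj; move: (kl i); rewrite !ffunE.
- exists [ffun i => Ordinal (kN i)] => //.
  by apply/ffunP => i; rewrite !ffunE.
Qed.

Lemma esum_subset (R : realType) (T : choiceType) (A A' : set T) (a : T -> \bar R) :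
  A `<=` A' -> (\esum_(k in A) a k <= \esum_(k in A') a k)%E.
Proof.
move=> AA'; apply: ereal_sup_le => _ [X [finX XA] <-].
by exists X => //; split=> //; exact: subset_trans AA'.
Qed.

Lemma index_box_homo (m N N' : nat) : (N <= N')%N ->
  index_box m N `<=` index_box m N'.
Proof. by move=> NN' k kN i; exact: leq_trans (kN i) NN'. Qed.

Lemma esum_box_sup (R : realType) (m : nat) (a : {ffun 'I_m -> nat} -> \bar R) :
  (\esum_(k in [set: {ffun 'I_m -> nat}]) a k =
   ereal_sup (range (fun N => \esum_(k in index_box m N) a k)))%E.
Proof.
apply/eqP; rewrite eq_le; apply/andP; split; last first.
  by apply: ge_ereal_sup => _ [N _ <-]; exact: esum_subset.
apply: ge_ereal_sup => _ [X [finX _] <-].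
have /finite_seqP[s Xs] := finX.
pose N := (\max_(k <- s) \max_i (k : {ffun 'I_m -> nat}) i)%N.+1.
apply: le_ereal_sup_tmp; exists (\esum_(k in index_box m N) a k)%E; first by exists N.
apply: esum_ge; exists X => //; split=> // k; rewrite Xs /= => ks i.
rewrite ltnS; apply: (@leq_trans (\max_i k i)%N); first exact: leq_bigmax.
exact: (leq_bigmax_seq _ ks isT).
Qed.

Lemma lee_poweR (R : realType) (x y : \bar R) (s : R) :
  0 <= s -> (0 <= x)%E -> (x <= y)%E -> (x `^ s <= y `^ s)%E.
Proof.
move=> s0 x0 xy; apply: gt0_ler_poweR => //; rewrite in_itv /= leey andbT //.
exact: le_trans xy.
Qed.

(** A positive power is increasing on [[0, +oo]] with inverse the power [s^-1], so each inequality
    is monotonicity of one of the two. *)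
Lemma poweR_range_sup (R : realType) (u : nat -> \bar R) (s : R) : 0 < s ->
  (forall N, 0 <= u N)%E ->
  ereal_sup (range (fun N => u N `^ s))%E = (ereal_sup (range u) `^ s)%E.
Proof.
move=> s0 u0; set z := ereal_sup (range (fun N => u N `^ s))%E.
have z0 : (0 <= z)%E.
  by apply: le_ereal_sup_tmp; exists (u 0%N `^ s)%E; [exists 0%N|exact: poweR_ge0].
have v0 : (0 <= ereal_sup (range u))%E.
  by apply: le_ereal_sup_tmp; exists (u 0%N); [exists 0%N|].
apply/eqP; rewrite eq_le; apply/andP; split.
  apply: ge_ereal_sup => _ [N _ <-].
  apply: lee_poweR => //; first exact: ltW.
  by apply: ereal_sup_ubound; exists N.
have zs : z = ((z `^ s^-1) `^ s)%E by rewrite -poweRrM mulVf ?poweRe1 ?gt_eqF.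
rewrite [leRHS]zs; apply: lee_poweR => //; first exact: ltW.
apply: ge_ereal_sup => _ [N _ <-].
have -> : u N = ((u N `^ s) `^ s^-1)%E by rewrite -poweRrM mulfV ?poweRe1 ?gt_eqF.
apply: lee_poweR; rewrite ?invr_ge0 ?(ltW s0) ?poweR_ge0 //.
by apply: ereal_sup_ubound; exists N.
Qed.

Lemma poweR_prod (R : realType) (m : nat) (a : 'I_m -> \bar R) (s : R) :
  (forall i, 0 <= a i)%E ->
  ((\big[*%E/1]_i a i) `^ s = \big[*%E/1]_i (a i `^ s))%E.
Proof.
move=> a0.
suff [//] : (\big[*%E/1]_i a i `^ s = (\big[*%E/1]_i a i) `^ s /\ 0 <= \big[*%E/1]_i a i)%E.
elim/big_ind2 : _ => [|x1 x2 y1 y2 [-> h1] [-> h2]|i _].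
- by rewrite poweR1r lee01.
- by rewrite poweRM // mule_ge0.
- by rewrite a0.
Qed.

Lemma lr_norm_measurable d (T : measurableType d) (R : realType) (r : R)
    (f : nat -> T -> R) : (forall k, measurable_fun setT (f k)) ->
  measurable_fun setT
    (fun x => ((\sum_(0 <= k <oo) (`|f k x| `^ r)%:E) `^ r^-1)%E).
Proof.
move=> mf; apply: (measurableT_comp (measurable_poweR r^-1)).
apply: (ge0_emeasurable_sum (P := xpredT)) => // k _.
by apply/measurable_EFinP; exact: measurable_powR_norm.
Qed.

Lemma truncated_lr_integral d (T : measurableType d) (R : realType)
    (mu : {measure set T -> \bar R}) (r q p : R) (f : nat -> T -> R) (N : nat) :
  0 < r -> 0 < q -> 0 < p -> (forall k, measurable_fun setT (f k)) ->
  ((\int[mu]_x ((\sum_(k < N) `|f k x| `^ r) `^ (q / r))%:E) `^ (p / q) <=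
   Lnorm mu q%:E (fun x => (\sum_(0 <= k <oo) (`|f k x| `^ r)%:E) `^ r^-1) `^ p)%E.
Proof.
move=> r0 q0 p0 mf; rewrite Lnorm.unlock -poweRrM [(q^-1 * p)%R]mulrC.
have mG := lr_norm_measurable r mf.
apply: lee_poweR; first by rewrite divr_ge0 ?ltW.
  by apply: integral_ge0 => x _; rewrite lee_fin powR_ge0.
apply: ge0_le_integral => //.
- by move=> x _; rewrite lee_fin powR_ge0.
- by apply/measurable_EFinP; exact: measurable_lr_sum.
- apply: (measurableT_comp (measurable_poweR q)).
  exact: measurableT_comp.
move=> x _; rewrite /= gee0_abs ?poweR_ge0 //. rewrite -poweRrM (mulrC r^-1) -poweR_EFin.
apply: lee_poweR; first by rewrite divr_ge0 ?ltW.
  by rewrite lee_fin sumr_ge0.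
rewrite -sumEFin -(big_mkord xpredT (fun k => (`|f k x| `^ r)%:E)).
by apply: nneseries_lim_ge => k _ _; rewrite lee_fin powR_ge0.
Qed.

(** The order of the quantifiers matters: [kappa] and [D] are fixed before the measures, [B], [phi],
    [H] and [N]. The [fine] loses nothing, box sums being finite. *)
Lemma box_marcinkiewicz_zygmund (R : realType) (m : nat) (p r : R) (q : 'I_m -> R) :
  (forall i, 1 <= q i) -> 0 < p -> (forall i, p <= q i) -> 0 < r ->
  ((forall i, q i < r) /\ r < 2) \/ r = 2 ->
  exists kappa D : R, [/\ 0 < kappa, 0 < D & forall (n : nat)
    (mu : 'I_m -> {measure set 'rV[R]_n -> \bar R})
    (nu : {measure set 'rV[R]_n -> \bar R})
    (B : ('I_m -> 'rV[R]_n -> R) -> 'rV[R]_n -> R) (phi : R -> R) (H : R)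
    (f : 'I_m -> nat -> 'rV[R]_n -> R) (N : nat),
  (forall t, 0 <= phi t) -> {in Num.nneg &, {homo phi : x y / x <= y}} ->
  measurable_fun setT phi -> 0 <= H ->
  (forall g, (forall i, g i \in Lfun (mu i) (q i)%:E) -> measurable_fun setT (B g)) ->
  multilinear_on (fun i g => g \in Lfun (mu i) (q i)%:E)
    (fun u v => u = v %[ae nu]) B ->
  (forall g, (forall i, g i \in Lfun (mu i) (q i)%:E) ->
    (\int[nu]_x (phi (kappa * `|B g x|))%:E <=
     H%:E * \big[*%E/1]_(i < m) Lnorm (mu i) (q i)%:E (EFin \o g i) `^ p)%E) ->
  (forall i k, f i k \in Lfun (mu i) (q i)%:E) ->
  (\int[nu]_x (phi (fine (\esum_(k in index_box m N)
      (`|B (fun i => f i (k i)) x| `^ r)%:E) `^ r^-1))%:E <=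
   (H * D)%:E * \big[*%E/1]_(i < m) Lnorm (mu i) (q i)%:E
     (fun x => (\sum_(0 <= k <oo) (`|f i k x| `^ r)%:E) `^ r^-1) `^ p)%E].
Proof.
move=> q1 p0 pq r0 qr.
have q0 i : 0 < q i by rewrite (lt_le_trans ltr01).
have [||c [d [c0 [d0 [U [P [th [PP ac KU]]]]]]]] :=
    @randomization R r (fun t => exists i, t = q i) _ r0.
- by move=> _ [i ->].
- by case: qr => [[qr r2]|r2]; [left; split=> // _ [i ->]|right].
have /choice[K hK] i : exists K : R, 0 < K /\ forall N (a : 'I_N -> R),
    \sum_u P N u * `|\sum_k a k * th N k u| `^ q i <=
    K * (\sum_k `|a k| `^ r) `^ (q i / r).
  by have [|K K0 hK] := KU (q i); [exists i|exists K].
exists (((c * (d / 2)) ^+ m) `^ r^-1)^-1,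
  (((d / 2) ^+ m)^-1 * \prod_i (2 * K i `^ (p / q i))).
have d20 : 0 < d / 2 by rewrite divr_gt0.
split.
- by rewrite invr_gt0 powR_gt0 // exprn_gt0 // mulr_gt0.
- rewrite mulr_gt0 ?invr_gt0 ?exprn_gt0 // prodr_gt0 // => i _.
  by rewrite mulr_gt0 // powR_gt0 //; have [] := hK i.
move=> n mu nu B phi H f N phi0 phih mphi H0 mB linB phiB fL.
have := @finite_marcinkiewicz_zygmund R n m N mu q nu B p r c d H K (U N) (P N)
  (th N) phi (fun i k => f i k) q1 p0 pq r0 c0 d0 H0 (fun i => (hK i).1) (PP N)
  (ac N) (fun i => (hK i).2 N) phi0 phih mphi mB linB _ (fun i k => fL i k).
move=> fin; apply: (le_trans _ (le_trans (fin _) _)).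
- rewrite le_eqVlt; apply/orP; left; apply/eqP; apply: eq_integral => x _.
  rewrite esum_index_box; last by move=> k; rewrite lee_fin powR_ge0.
  rewrite sumEFin /=; congr (phi (_ `^ _))%:E; apply: eq_bigr => k _.
  congr (`|B _ x| `^ r); apply/funext => i; by rewrite ffunE.
- move=> g gL; apply: le_trans (phiB g gL); rewrite le_eqVlt; apply/orP; left.
  by apply/eqP; apply: eq_integral => x _; rewrite mulrC.
- rewrite mulrA lee_wpmul2l ?lee_fin //.
    rewrite mulr_ge0 ?divr_ge0 ?exprn_ge0 ?(ltW d20) // prodr_ge0 // => i _.
    by rewrite mulr_ge0 ?powR_ge0.
  apply: lee_prod => i; rewrite poweR_ge0 /=.
  apply: truncated_lr_integral => // k.
  exact: Lfun_measurable (fL i k).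
Qed.

Lemma esum_box_measurable d (T : measurableType d) (R : realType) (m N : nat)
    (a : {ffun 'I_m -> nat} -> T -> R) :
  (forall k, measurable_fun setT (a k)) -> (forall k x, 0 <= a k x) ->
  measurable_fun setT (fun x => \esum_(k in index_box m N) (a k x)%:E)%E.
Proof.
move=> ma a0; apply: (eq_measurable_fun (fun x =>
    (\sum_(k : {ffun 'I_m -> 'I_N}) a [ffun i => k i : nat] x)%:E)) => [x _|].
  by rewrite esum_index_box ?sumEFin // => k; rewrite lee_fin.
by apply/measurable_EFinP; apply: measurable_sum.
Qed.

Lemma esum_box_fin (R : realType) (m N : nat) (a : {ffun 'I_m -> nat} -> R) :
  (forall k, 0 <= a k) ->
  (\esum_(k in index_box m N) (a k)%:E)%E \is a fin_num.
Proof.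
by move=> a0; rewrite esum_index_box ?sumEFin // => k; rewrite lee_fin.
Qed.

Lemma integral_esum_le d (T : measurableType d) (R : realType)
    (nu : {measure set T -> \bar R}) (m : nat) (a : {ffun 'I_m -> nat} -> T -> R)
    (s t : R) (M : \bar R) : 0 < s -> 0 < t ->
  (forall k, measurable_fun setT (a k)) -> (forall k x, 0 <= a k x) ->
  (forall N, (\int[nu]_x
     ((fine (\esum_(k in index_box m N) (a k x)%:E)%E `^ s) `^ t)%:E <= M)%E) ->
  (\int[nu]_x `|(\esum_(k in [set: {ffun 'I_m -> nat}]) (a k x)%:E) `^ s| `^ t <= M)%E.
Proof.
move=> s0 t0 ma a0 hM.
have st0 : 0 < s * t by rewrite mulr_gt0.
pose e N x := (\esum_(k in index_box m N) (a k x)%:E)%E.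
have e0 N x : (0 <= e N x)%E by apply: esum_ge0 => k _; rewrite lee_fin.
have me N : measurable_fun setT (fun x => e N x `^ (s * t))%E.
  exact: (measurableT_comp (measurable_poweR (s * t))) (esum_box_measurable N ma a0).
have he x N N' : (N <= N')%N -> (e N x `^ (s * t) <= e N' x `^ (s * t))%E.
  move=> NN'; apply: lee_poweR; rewrite ?(ltW st0) //.
  by apply: esum_subset; exact: index_box_homo.
rewrite (eq_integral (fun x => limn (fun N => e N x `^ (s * t))%E)); last first.
  move=> x _; rewrite gee0_abs ?poweR_ge0 // -poweRrM esum_box_sup.
  rewrite -(poweR_range_sup st0 (fun N => e0 N x)); apply/esym/cvg_lim => //.
  by apply: ereal_nondecreasing_cvgn => N N'; exact: he.
rewrite monotone_convergence //; last 2 first.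
- by move=> N x _; exact: poweR_ge0.
- by move=> x _ N N'; exact: he.
apply: lime_le.
  apply: ereal_nondecreasing_is_cvgn => N N' NN'.
  apply: ge0_le_integral => // x _; [exact: poweR_ge0|exact: he].
apply: nearW => N; apply: le_trans (hM N); rewrite le_eqVlt; apply/orP; left.
apply/eqP; apply: eq_integral => x _.
by rewrite /e -{1}(fineK (esum_box_fin N (a0^~ x))) poweRrM !poweR_EFin.
Qed.

Lemma measure_esum_le d (T : measurableType d) (R : realType)
    (nu : {measure set T -> \bar R}) (m : nat) (a : {ffun 'I_m -> nat} -> T -> R)
    (s l : R) (M : \bar R) : 0 < s ->
  (forall k, measurable_fun setT (a k)) -> (forall k x, 0 <= a k x) ->
  (forall N, (nu [set x |
     (l < fine (\esum_(k in index_box m N) (a k x)%:E)%E `^ s)%R] <= M)%E) ->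
  (nu [set x | l%:E < `|(\esum_(k in [set: {ffun 'I_m -> nat}]) (a k x)%:E) `^ s|]
   <= M)%E.
Proof.
move=> s0 ma a0 hM.
pose e N x := (\esum_(k in index_box m N) (a k x)%:E)%E.
have e0 N x : (0 <= e N x)%E by apply: esum_ge0 => k _; rewrite lee_fin.
pose E N := [set x | (l%:E < e N x `^ s)%E].
have mE N : measurable (E N).
  rewrite -[E N]setTI; apply: (emeasurable_fun_o_infty measurableT).
  exact: (measurableT_comp (measurable_poweR s)) (esum_box_measurable N ma a0).
(* The strict inequality makes the level set exactly an increasing union: a supremum above [l] has a
   term above [l]. *)
have -> : [set x | l%:E < `|(\esum_(k in [set: {ffun 'I_m -> nat}]) (a k x)%:E) `^ s|]%E
    = \bigcup_N E N.
  apply/seteqP; split=> x /=.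
    rewrite gee0_abs ?poweR_ge0 // esum_box_sup.
    rewrite -(poweR_range_sup s0 (fun N => e0 N x)).
    by move=> /ereal_sup_gt[_ [N _ <-] lN]; exists N.
  move=> [N _ lN]; rewrite gee0_abs ?poweR_ge0 //; apply: (lt_le_trans lN).
  by apply: lee_poweR; rewrite ?(ltW s0) //; exact: esum_subset.
have cvgE : nu \o E @ \oo --> nu (\bigcup_N E N).
  apply: nondecreasing_cvg_mu => //; first exact: bigcup_measurable.
  move=> N N' NN'; apply/subsetPset => x; rewrite /E /= => /lt_le_trans; apply.
  apply: lee_poweR; rewrite ?(ltW s0) //.
  by apply: esum_subset; exact: index_box_homo.
rewrite -(cvg_lim _ cvgE) //; apply: lime_le; first by apply: cvgP cvgE.
apply: nearW => N; apply: le_trans (hM N).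
rewrite le_eqVlt; apply/orP; left; apply/eqP; congr (nu _).
apply/seteqP; split=> x; rewrite /E /= /e -(fineK (esum_box_fin N (a0^~ x)));
  by rewrite poweR_EFin lte_fin.
Qed.

(** * Strong and weak estimates for infinite families *)

Lemma poweR_bound (R : realType) (m : nat) (p a D : R) (G : 'I_m -> \bar R)
    (V : \bar R) : 0 < p -> 0 <= a -> 0 <= D -> (0 <= V)%E ->
  (forall i, 0 <= G i)%E ->
  (V <= (a `^ p * D)%:E * \big[*%E/1]_i (G i `^ p))%E ->
  (V `^ p^-1 <= (a * D `^ p^-1)%:E * \big[*%E/1]_i G i)%E.
Proof.
move=> p0 a0 D0 V0 G0 VM; have pV : 0 <= p^-1 by rewrite invr_ge0 ltW.
have pp : p * p^-1 = 1 by rewrite mulfV // gt_eqF.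
apply: le_trans (lee_poweR pV V0 VM) _.
have prod0 : (0 <= \big[*%E/1]_i (G i `^ p))%E.
  by apply: prode_ge0 => i _; exact: poweR_ge0.
rewrite poweRM ?lee_fin ?mulr_ge0 ?powR_ge0 // poweR_EFin powRM ?powR_ge0 //.
rewrite -powRrM pp powRr1 // poweR_prod => [|i]; last exact: poweR_ge0.
by under eq_bigr do rewrite -poweRrM pp poweRe1 //.
Qed.

Lemma multilinear_marcinkiewicz_zygmund (R : realType) (m : nat) (p r : R)
    (q : 'I_m -> R) :
  (forall i, 1 <= q i) -> 0 < p -> (forall i, p <= q i) -> 0 < r ->
  ((forall i, q i < r) /\ r < 2) \/ r = 2 ->
  exists2 C : R, 0 < C & forall (n : nat)
    (mu : 'I_m -> {measure set 'rV[R]_n -> \bar R})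
    (nu : {measure set 'rV[R]_n -> \bar R})
    (B : ('I_m -> 'rV[R]_n -> R) -> 'rV[R]_n -> R)
    (f : 'I_m -> nat -> 'rV[R]_n -> R),
  (forall i k, f i k \in Lfun (mu i) (q i)%:E) ->
  let F x := ((\esum_(k in [set: {ffun 'I_m -> nat}])
    (`|B (fun i => f i (k i)) x| `^ r)%:E) `^ r^-1)%E in
  let G i x := ((\sum_(0 <= k <oo) (`|f i k x| `^ r)%:E) `^ r^-1)%E in
  let bound N := (C%:E * operator_norm mu q N B *
    \big[*%E/1]_(i < m) Lnorm (mu i) (q i)%:E (G i))%E in
  (bounded_multilinear mu q nu (Lnorm nu p%:E) B ->
    (Lnorm nu p%:E F <= bound (Lnorm nu p%:E))%E) /\
  (bounded_multilinear mu q nu (weak_Lnorm nu p) B ->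
    (weak_Lnorm nu p F <= bound (weak_Lnorm nu p))%E).
Proof.
move=> q1 p0 pq r0 qr.
have [kappa [D [k0 D0 main]]] := box_marcinkiewicz_zygmund q1 p0 pq r0 qr.
have pV : 0 <= p^-1 by rewrite invr_ge0 ltW.
have pp : p^-1 * p = 1 by rewrite mulVf // gt_eqF.
exists (kappa * D `^ p^-1); first by rewrite mulr_gt0 // powR_gt0.
move=> n mu nu B f fL F G bound.
have G0 i : (0 <= Lnorm (mu i) (q i)%:E (G i))%E by exact: Lnorm_ge0.
have normE N : homogeneous_norm nu N -> bounded_multilinear mu q nu N B ->
    exists2 L : R, 0 <= L & operator_norm mu q N B = L%:E.
  move=> hN bB; have L0 := operator_norm_ge0 mu B q1 hN.
  exists (fine (operator_norm mu q N B)); first exact: fine_ge0.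
  by rewrite fineK // ge0_fin_numE // (operator_norm_lty bB).
have mb N (bB : bounded_multilinear mu q nu N B) (k : {ffun 'I_m -> nat}) :
    measurable_fun setT (fun x => `|B (fun i => f i (k i)) x| `^ r).
  have [mB _ _] := bB.
  by apply: measurable_powR_norm; apply: mB => i; exact: fL.
have b0 (k : {ffun 'I_m -> nat}) x : 0 <= `|B (fun i => f i (k i)) x| `^ r.
  exact: powR_ge0.
have rhsE (t : R) (g : 'I_m -> 'rV[R]_n -> R) : 0 <= t ->
    ((t `^ p)%:E * \big[*%E/1]_(i < m) Lnorm (mu i) (q i)%:E (EFin \o g i) `^ p =
     (t%:E * \big[*%E/1]_(i < m) Lnorm (mu i) (q i)%:E (EFin \o g i)) `^ p)%E.
  move=> t0; rewrite poweRM ?lee_fin ?poweR_EFin ?poweR_prod // => [i|].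
    exact: Lnorm_ge0.
  by apply: prode_ge0 => i _; exact: Lnorm_ge0.
split=> bB; have [mB linB _] := bB.
- have hN := homogeneous_Lnorm nu p0.
  have [L L0 LE] := normE _ hN bB.
  rewrite /bound LE -EFinM mulrAC [kappa * L]mulrC; 
  have -> : (Lnorm nu p%:E F = (\int[nu]_x `|F x| `^ p) `^ p^-1)%E.
    by rewrite Lnorm.unlock.
  apply: poweR_bound => //; rewrite ?mulr_ge0 ?(ltW k0) ?(ltW D0) //.
    by apply: integral_ge0 => x _; exact: poweR_ge0.
  apply: integral_esum_le => //; [by rewrite invr_gt0|exact: mb bB|].
  (* For the power [t ^ p] the factor [kappa] comes out of the norm, so that
     [H = (L * kappa) ^ p]. *)
  move=> N; apply: (main n mu nu B (fun t => t `^ p)) => //.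
  + by move=> t; exact: powR_ge0.
  + by move=> x y x0 y0 xy; apply: ge0_ler_powR => //; exact: ltW.
  + exact: powR_ge0.
  move=> g gL; have := operator_norm_bound q1 hN bB gL; rewrite LE => NB.
  have -> : (\int[nu]_x ((kappa * `|B g x|) `^ p)%:E =
      Lnorm nu p%:E (EFin \o (fun x => B g x * kappa)%R) `^ p)%E.
    rewrite poweR_Lnorm ?gt_eqF //; apply: eq_integral => x _.
    by rewrite /= normrM (gtr0_norm k0) mulrC.
  rewrite (LnormZl _ _ p0 (mB g gL)) (gtr0_norm k0).
  rewrite rhsE ?mulr_ge0 ?(ltW k0) //.
  apply: lee_poweR; [exact: ltW|by rewrite mule_ge0 ?Lnorm_ge0 ?lee_fin ?(ltW k0)|].
  by rewrite mulrC EFinM -muleA lee_wpmul2l ?lee_fin ?(ltW k0).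
- have hN := homogeneous_weak_Lnorm nu p0.
  have [L L0 LE] := normE _ hN bB.
  apply: ge_ereal_sup => _ [l /= l0 <-].
  have lV0 : 0 < l^-1 by rewrite invr_gt0.
  have a0 : 0 <= L * kappa / l by rewrite !mulr_ge0 ?(ltW k0) ?(ltW lV0).
  suff : (nu [set x | l%:E < `|F x|] `^ p^-1 <= (L * kappa / l * D `^ p^-1)%:E *
      \big[*%E/1]_(i < m) Lnorm (mu i) (q i)%:E (G i))%E.
    move=> /(lee_wpmul2l (x := l%:E)); rewrite lee_fin (ltW l0) => /(_ isT).
    move=> /le_trans; apply; rewrite /bound LE muleA -!EFinM.
    rewrite le_eqVlt; apply/orP; left; apply/eqP; congr (_%:E * _)%E.
    by field; rewrite gt_eqF.
  apply: poweR_bound => //; rewrite ?(ltW D0) //.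
  have mray : measurable [set t : R | l < t].
    by rewrite -set_itvoy; exact: measurable_itv.
  have indicator (h : 'rV[R]_n -> R) : measurable_fun setT h ->
      (\int[nu]_x (\1_[set t | l < t] (h x))%:E = nu [set x | (l < h x)%R])%E.
    move=> mh; rewrite -[X in nu X]setIT -integral_indic //.
    by rewrite -[X in measurable X]setTI; exact: mh measurableT _ mray.
  apply: measure_esum_le => //; [by rewrite invr_gt0|exact: mb bB|].
  move=> N; rewrite -indicator; last first.
    apply: (measurableT_comp (measurable_powR r^-1)).
    apply: (measurableT_comp (fine_measurable measurableT)) => //.
    by apply: esum_box_measurable => //; exact: mb bB.
  (* The integral becomes the measure of the set where [kappa * |B g|] exceeds [l]; the weak norm at
     level [l / kappa] gives [H = (L * kappa / l) ^ p]. *)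
  apply: (main n mu nu B (\1_[set t | l < t])) => //.
  + move=> x y x0 y0 xy; rewrite !indicE ler_nat; apply: leq_b_imp.
    by rewrite !inE => /lt_le_trans; apply.
  + exact: powR_ge0.
  move=> g gL; have := operator_norm_bound q1 hN bB gL; rewrite LE => NB.
  rewrite indicator; last first.
    apply: measurable_funM => //; apply: measurableT_comp => //; exact: mB.
  have -> : [set x | l < kappa * `|B g x|] =
      [set x | ((l / kappa)%:E < `|(EFin \o B g) x|)%E].
    by apply/funext => x; rewrite /= lte_fin ltr_pdivrMr // mulrC.
  rewrite rhsE //.
  set V := nu _; have V0 : (0 <= V)%E by exact: measure_ge0.
  have -> : V = ((V `^ p^-1) `^ p)%E by rewrite -poweRrM pp poweRe1.
  apply: lee_poweR; [exact: ltW|exact: poweR_ge0|].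
  have lk0 : 0 < l / kappa by rewrite divr_gt0.
  have Vle : ((l / kappa)%:E * V `^ p^-1 <= weak_Lnorm nu p (EFin \o B g))%E.
    by apply: ereal_sup_ubound; exists (l / kappa).
  rewrite -(lee_pmul2l (x := (l / kappa)%:E)) ?lte_fin //.
  apply: (le_trans Vle); apply: (le_trans NB); rewrite muleA -EFinM.
  rewrite le_eqVlt; apply/orP; left; apply/eqP; congr (_%:E * _)%E.
  by field; rewrite !gt_eqF.
Qed.

Theorem corollary5p4 (R : realType) (m n : nat) (r p : R) (q : 'I_m -> R)
    (w : 'I_m -> {mfun 'rV[R]_n >-> R})
    (m_gt0 : (0 < m)%N) (n_gt0 : (0 < n)%N)
    (q_ge1 : forall i, 1 <= q i)
    (qr : ((forall i, q i < r) /\ r < 2) \/ r = 2)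
    (p_gt0 : 0 < p) (pq : p^-1 = \sum_i (q i)^-1)
    (w_weight : forall i, is_weight (w i))
    (w_Aq : multilinear_Aq q p w) :
  let mu : 'I_m -> {measure set 'rV[R]_n -> \bar R} :=
    fun i => weighted (w i) in
  let nu : {measure set 'rV[R]_n -> \bar R} :=
    weighted (product_weight q p w) in
  let Lp := Lnorm nu p%:E in
  let weakLp := weak_Lnorm nu p in
  exists2 C : R, 0 < C &
    forall (T : ('I_m -> 'rV[R]_n -> R) -> ('rV[R]_n -> R) -> R)
      (f : 'I_m -> nat -> 'rV[R]_n -> R),
    calderon_zygmund T ->
    (forall i k, f i k \in Lfun (mu i) (q i)%:E) ->
    let F := fun (B : ('I_m -> 'rV[R]_n -> R) -> 'rV[R]_n -> R) x =>
      ((\esum_(k in [set: {ffun 'I_m -> nat}])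
          (`|B (fun i => f i (k i)) x| `^ r)%:E) `^ r^-1)%E in
    let G := fun i x =>
      ((\sum_(0 <= k <oo) (`|f i k x| `^ r)%:E) `^ r^-1)%E in
    ((forall i, 1 < q i) ->
     forall B, bounded_extension mu q nu Lp T B ->
     (Lp (F B) <= C%:E * operator_norm mu q Lp B *
        \big[*%E/1]_(i < m) Lnorm (mu i) (q i)%:E (G i))%E) /\
    ((exists i, q i = 1) ->
     forall B, bounded_extension mu q nu weakLp T B ->
     (weakLp (F B) <= (C * expR p^-1)%:E * operator_norm mu q weakLp B *
        \big[*%E/1]_(i < m) Lnorm (mu i) (q i)%:E (G i))%E).
Proof.
move=> mu nu Lp weakLp.
have r_gt0 : 0 < r.
  case: qr => [[qr _]|->] //.
  by have := qr (Ordinal m_gt0); have := q_ge1 (Ordinal m_gt0); lra.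
have q_gt0 i : 0 < q i by rewrite (lt_le_trans ltr01).
have pq_le i : p <= q i.
  rewrite -lef_pV2 ?posrE // pq (bigD1 i) //= lerDl sumr_ge0 // => j _.
  by rewrite invr_ge0 ltW.
have [C C0 hC] := multilinear_marcinkiewicz_zygmund q_ge1 p_gt0 pq_le r_gt0 qr.
exists C => // T f _ fL F G; split=> [_|_] B [bB _].
  exact: (hC n mu nu B f fL).1 bB.
(* The weak estimate holds with [C], and [1 <= expR p^-1] turns it into the stated one. *)
apply: le_trans ((hC n mu nu B f fL).2 bB) _.
rewrite -!muleA lee_wpmul2r //.
  rewrite mule_ge0 ?(operator_norm_ge0 _ _ q_ge1 (homogeneous_weak_Lnorm nu p_gt0)) //.
  by apply: prode_ge0 => i _; exact: Lnorm_ge0.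
rewrite lee_fin ler_peMr ?(ltW C0) //.
by have := expR_ge1Dx p^-1; have : 0 < p^-1; [rewrite invr_gt0|lra].
Qed.
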